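(* Let $n\ge1$. Let $D$ be a weighted oriented graph with $V^+\neq\emptyset$ in which all elements of $V^+$ are sinks, and whose underlying graph $G$ is a unicyclic graph with unique cycle $C_{2n+1}=(x_1,\dots,x_{2n+1})$. Let $\tilde I=I(D)$ be the edge ideal of $D$, and let $$c=\Bigl(\prod_{x_j\in V(C_{2n+1})\setminus V^+}x_j\Bigr)\Bigl(\prod_{x_j\in V(C_{2n+1})\cap V^+}x_j^{w(x_j)}\Bigr).$$ Then: (1) $\tilde I^{(k)}=\tilde I^{\,k}$ for $1\le k\le n$, and $\tilde I^{(n+1)}=\tilde I^{\,n+1}+(c)$. (2) Let $s\in\mathbb{N}$ and write $s=k(n+1)+r$ with $k\in\mathbb{Z}$ and $0\le r\le n$. Then $$\tilde I^{(s)}=\sum_{t=0}^{k}\tilde I^{\,s-t(n+1)}(c)^t.$$ (3) If no vertex of $V(C_{2n+1})$ is in $V^+$ and some vertex of $V(G)\setminus V(C_{2n+1})$ is in $V^+$, then $\alpha(\tilde I^{(s)})=2s-\left\lfloor\frac{s}{n+1}\right\rfloor$ for all $s\in\mathbb{N}$. In particular, the Waldschmidt constant of $\tilde I$ is $\widehat{\alpha}(\tilde I)=\frac{2n+1}{n+1}$. (4) If at least one vertex of $V(C_{2n+1})$ is in $V^+$, then $\alpha(\tilde I^{(s)})=2s$ for all $s\in\mathbb{N}$. In particular, the Waldschmidt constant of $\tilde I$ is $\widehat{\alpha}(\tilde I)=2$.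
   Context: A weighted oriented graph $D=(V(D),E(D),w)$ consists of a finite simple graph $G$ (the underlying graph) with $V(G)=V(D)$, an orientation of each edge of $G$ (the pair $(x,y)\in E(D)$ denotes the edge directed from $x$ to $y$), and a weight function $w:V(D)\to\mathbb{N}=\{1,2,\dots\}$. If $x$ is a source (only arrows leaving $x$), one always assumes $w(x)=1$. Set $V^+=\{x\in V(D): w(x)\neq 1\}$. A vertex $x$ is a sink if all edges at $x$ are directed into $x$. Let $R$ be the polynomial ring over a field $K$ whose variables are the vertices of $D$. The edge ideal of $D$ is $I(D)=(xy^{w(y)} : (x,y)\in E(D))\subseteq R$. A unicyclic graph is a connected graph with exactly one cycle. For a homogeneous ideal $I\subset R$, the $m$-th symbolic power is $I^{(m)}=\bigcap_{p\in \mathrm{Ass}(I)}(I^mR_p\cap R)$, the intersection being over all associated primes of $I$; $I^0=R$. For a nonzero homogeneous ideal $I$, $\alpha(I)=\min\{d: I_d\neq0\}$ is the smallest degree of a nonzero element of $I$ (with the standard grading), and the Waldschmidt constant is $\widehat{\alpha}(I)=\lim_{s\to\infty}\alpha(I^{(s)})/s$. *)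

(* Defs.v *)
(* Importing mpoly after MathComp-Analysis fails (clashing notation levels). *)
From mathcomp Require Import all_boot all_order all_algebra.
From mathcomp Require Import mpoly.
From mathcomp Require Import boolp classical_sets reals topology normedtype.
From mathcomp Require Import sequences.

Set Implicit Arguments.
Unset Strict Implicit.
Unset Printing Implicit Defensive.

Import Order.TTheory GRing.Theory Num.Theory.
Import numFieldNormedType.Exports.

Local Open Scope classical_set_scope.
Local Open Scope ring_scope.

(* The underlying simple graph is read off from [arc]: antisymmetry excludes
   both loops and pairs of opposite arcs. *)
Record wograph (V : finType) := WOGraph {
  arc : rel V;
  weight : V -> nat;
  arc_asym : forall x y : V, arc x y -> ~~ arc y x;
  weight_gt0 : forall x : V, (0 < weight x)%N;
  weight_source : forall x : V, (forall y : V, ~~ arc y x) -> weight x = 1%N }.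

Section Graphs.
Variables (V : finType) (D : wograph V).

Definition adj : rel V := fun x y => arc D x y || arc D y x.

Definition Vplus : {set V} := [set x | weight D x != 1%N]%SET.

Definition is_sink (x : V) : Prop := forall y : V, ~~ arc D x y.

Definition is_cycle (p : seq V) : Prop := (2 < size p)%N /\ ucycle adj p.

Definition cycle_edges (p : seq V) : {set {set V}} :=
  [set [set x; next p x]%SET | x in p]%SET.

(* A cycle is a subgraph, so two vertex sequences that list the same edges
   (rotations and reversals of each other) are the same cycle. *)
Definition unicyclic_with_cycle (p : seq V) : Prop :=
  [/\ forall x y : V, connect adj x y,
      is_cycle p &
      forall q : seq V, is_cycle q -> cycle_edges q = cycle_edges p].

End Graphs.

Section Ideals.

(* With [A] a subring, this is the [A]-submodule generated by [G]. *)
Definition lin_span (R : comNzRingType) (A G : set R) : set R :=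
  [set z | exists (m : nat) (a g : 'I_m -> R),
     [/\ forall i, A (a i), forall i, G (g i) & z = \sum_(i < m) a i * g i]].

Variable R : idomainType.
Implicit Types (I J p : set R).

Definition ideal_gen (G : set R) : set R := lin_span setT G.

Definition is_ideal I : Prop :=
  [/\ I 0, forall a b, I a -> I b -> I (a + b) & forall a b, I b -> I (a * b)].

Definition is_prime_ideal p : Prop :=
  [/\ is_ideal p, ~ p 1 & forall a b, p (a * b) -> p a \/ p b].

Definition ideal0 : set R := [set 0].

Definition ideal_add I J : set R := [set a + b | a in I & b in J].

Definition ideal_mul I J : set R := ideal_gen [set a * b | a in I & b in J].

Definition ideal_pow I (k : nat) : set R := iter k (ideal_mul I) setT.

(* [p = (I : f)], the annihilator of the class of [f] in [R / I]. *)
Definition Ass I : set (set R) :=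
  [set p | is_prime_ideal p /\ exists f : R, p = [set g | I (g * f)]].

(* R_p, as a subring of the fraction field of the domain R. *)
Definition localization p : set {fraction R} :=
  [set z | exists a s : R, ~ p s /\ z = tofrac a / tofrac s].

Definition loc_contract p J : set R :=
  @tofrac R @^-1` lin_span (localization p) (@tofrac R @` J).

Definition symbolic_power I (m : nat) : set R :=
  \bigcap_(p in Ass I) loc_contract p (ideal_pow I m).

End Ideals.

Section Grading.
Variables (n : nat) (K : fieldType).
Implicit Type I : set {mpoly K[n]}.

Definition has_degree I (d : nat) : Prop :=
  exists f : {mpoly K[n]}, [/\ I f, f != 0 & f \is d.-homog].

(* [alpha I] is only meaningful if [I] contains a nonzero form; it is then the
   unique element of the set below. *)
Definition alpha I : nat :=
  xget 0%N [set d | has_degree I d /\ forall e, has_degree I e -> (d <= e)%N].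

Definition waldschmidt_seq (R : realType) I : R ^nat :=
  fun s => (alpha (symbolic_power I s))%:R / s%:R.

Definition waldschmidt (R : realType) I : R :=
  lim (waldschmidt_seq R I @ \oo).

End Grading.

Section EdgeIdeal.
Variables (K : fieldType) (V : finType) (D : wograph V).

Definition Xv (x : V) : {mpoly K[#|V|]} := 'X_(enum_rank x).

Definition edge_ideal : set {mpoly K[#|V|]} :=
  ideal_gen [set m | exists x y : V, arc D x y /\ m = Xv x * Xv y ^+ weight D y].

Definition cycle_monomial (p : seq V) : {mpoly K[#|V|]} :=
  (\prod_(x <- p | x \notin Vplus D) Xv x) *
  (\prod_(x <- p | x \in Vplus D) Xv x ^+ weight D x).

End EdgeIdeal.

Arguments ideal0 {R}.
Arguments edge_ideal K {V} D.
Arguments cycle_monomial K {V} D p.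

(* Main.v *)
Require Import Defs.
From mathcomp Require Import all_boot zify boolp.

(* Write q_v for the quotient of the exponent of v by w(v). As the vertices of
   weight > 1 are sinks, the generator of an edge uv is u^w(u) v^w(v), so a
   monomial lies in I^s c^t iff s edges and t copies of the cycle can be packed
   into q. The associated primes of I are generated by the minimal vertex covers
   W, and W contributes the condition q(W) >= s, whence the monomials of the
   symbolic power I^(s) are those for which every vertex cover has q-weight at
   least s. Everything therefore rests on a min-max theorem: the minimal weight
   of a vertex cover equals the maximal value of a packing of edges (of value 1)
   and copies of the odd cycle (of value n + 1). It is proved by peeling edges at
   leaves of the support of q, and once the support is the odd cycle by peeling
   an edge contained in no lightest cover, which exists unless q is constant. *)

Set Implicit Arguments.
Unset Strict Implicit.
Unset Printing Implicit Defensive.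

(** * Structure of a unicyclic graph: chords, avoiding paths, parents *)

Section OddUnicyclic.
Local Open Scope nat_scope.
Variables (V : finType) (D : wograph V) (C : seq V).
Hypothesis hC : unicyclic_with_cycle D C.
Implicit Types (x y u v : V) (b : V -> nat).

Lemma adjC x y : adj D x y = adj D y x.
Proof. by rewrite /adj orbC. Qed.

Lemma adj_irr x : adj D x x = false.
Proof. by apply/negP; rewrite /adj orbb => h; move/negP: (arc_asym h). Qed.

Lemma adj_neq x y : adj D x y -> x != y.
Proof. by apply: contraTneq => ->; rewrite adj_irr. Qed.

Let C_cycle : cycle (adj D) C. Proof. by case: hC => _ [_ /andP[]]. Qed.
Let C_uniq : uniq C. Proof. by case: hC => _ [_ /andP[]]. Qed.
Let C_size : 2 < size C. Proof. by case: hC => _ []. Qed.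

Lemma cycle_edge_eq q x : is_cycle D q -> x \in q ->
  exists2 y, y \in C & [set x; next q x] = [set y; next C y].
Proof.
move=> hq xq; case: hC => _ _ /(_ _ hq) E.
have : [set x; next q x] \in cycle_edges q by apply/imsetP; exists x.
by rewrite E => /imsetP[y yC ->]; exists y.
Qed.

Lemma cycle_subset q x : is_cycle D q -> x \in q -> x \in C.
Proof.
move=> hq xq; have [y yC E] := cycle_edge_eq hq xq.
have : x \in [set y; next C y] by rewrite -E set21.
by rewrite !inE => /orP[] /eqP ->; rewrite ?mem_next.
Qed.

(** Unless [v] directly follows [u], the arc of [C] from [u] to [v] closed up by the edge [uv] is a
    cycle. Its edges are then those of [C], so [uv] is itself an edge of [C]. *)
Lemma cycle_chordless u v : u \in C -> v \in C -> adj D u v ->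
  v = next C u \/ u = next C v.
Proof.
move=> uC vC uv; have nuv := adj_neq uv.
have [i s Es] := rot_to uC.
have s_uniq : uniq (u :: s) by rewrite -Es rot_uniq.
have s_cycle : cycle (adj D) (u :: s) by rewrite -Es rot_cycle.
have vs : v \in s.
  by move: vC; rewrite -(mem_rot i) Es inE eq_sym (negPf nuv).
have nx w : next (u :: s) w = next C w by rewrite -Es next_rot.
case/splitPr: vs Es s_uniq s_cycle nx => p1 p2 Es s_uniq s_cycle nx.
case: p1 Es s_uniq s_cycle nx => [|a p1] Es s_uniq s_cycle nx.
  by left; rewrite -nx /= eqxx.
have hq : is_cycle D (u :: rcons (a :: p1) v).
  split; first by rewrite /= size_rcons.
  apply/andP; split; last first.
    move: s_uniq; rewrite -cat_rcons -cat_cons cat_uniq => /andP[] //.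
  rewrite /= !rcons_path last_rcons (adjC v) uv andbT.
  by move: s_cycle; rewrite /= rcons_cat /= cat_path /= => /and3P[-> -> /andP[-> _]].
have vq : v \in u :: rcons (a :: p1) v by rewrite inE mem_rcons inE eqxx orbT.
have nv : next (u :: rcons (a :: p1) v) v = u.
  have q_uniq : uniq (u :: rcons (a :: p1) v) by case: hq => _ /andP[].
  have [n0 E] : exists k, rot k (u :: rcons (a :: p1) v) = v :: u :: (a :: p1).
    exists (size (u :: (a :: p1))).
    by rewrite -rcons_cons -cats1 rot_size_cat.
  by rewrite -(next_rot n0) // E /= eqxx.
have [y yC] := cycle_edge_eq hq vq; rewrite nv => E.
have : u \in [set y; next C y] by rewrite -E set22.
have : v \in [set y; next C y] by rewrite -E set21.
rewrite !inE => /orP[] /eqP ev /orP[] /eqP eu.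
- by rewrite eu -ev eqxx in nuv.
- by right; rewrite eu ev.
- by left; rewrite eu ev.
- by rewrite eu -ev eqxx in nuv.
Qed.

Let avoid v : rel V := fun x y => [&& adj D x y, x != v & y != v].

(** A simple path from [u1] to [u2] that avoids [v] closes up through [v] to a cycle, and every
    cycle has its vertices in [C]. *)
Lemma mem_cycle_of_avoiding_path v u1 u2 : u1 != u2 -> adj D v u1 ->
  adj D v u2 -> connect (avoid v) u1 u2 -> v \in C.
Proof.
move=> n12 a1 a2 /connectP[p0 hp0 E].
move: n12 a2; rewrite {}E; case/shortenP: hp0 => p hp up _ n12 a2.
apply: (@cycle_subset (v :: u1 :: p)); last exact: mem_head.
have vp : v \notin u1 :: p.
  rewrite inE negb_or adj_neq //=.
  elim: p (u1) hp {up n12 a1 a2} => //= z p IH x /andP[/and3P[_ _ zv] hp].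
  by rewrite inE negb_or eq_sym zv (IH z).
split; first by case: p n12 {hp up a2 vp} => //; rewrite eqxx.
apply/andP; split; last by rewrite cons_uniq vp.
rewrite /= rcons_path a1 (adjC _ v) a2 andbT.
by apply: sub_path hp => x y /and3P[].
Qed.

Lemma connect_avoid_in_cycle v : v \notin C ->
  {in C &, forall x y, connect (avoid v) x y}.
Proof.
move=> vC; apply: connect_cycle; apply: cycle_from_next => // x xC.
apply/and3P; split; first exact: next_cycle.
- by apply: contraNneq vC => <-.
- by apply: contraNneq vC => <-; rewrite mem_next.
Qed.

(** [d] is the distance to [C], and [u] is the first step of a shortest path. *)
Lemma dist_to_cycle : exists d : V -> nat, forall v, v \notin C ->
  exists2 u, adj D v u & d u < d v.
Proof.
case: hC => conn _ _.
have [c0 c0C] : exists c, c \in C.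
  by case: C C_size => // c ? _; exists c; rewrite mem_head.
pose P v k := exists p : seq V, [/\ size p = k, path (adj D) v p & last v p \in C].
have exP v : exists k, `[< P v k >].
  have /connectP[p hp E] := conn v c0.
  by exists (size p); apply/asboolP; exists p; rewrite -E.
exists (fun v => ex_minn (exP v)) => v vC.
case: ex_minnP => k /asboolP[[|u p] [sp hp lp]] kmin.
  by rewrite (negPf vC) in lp.
move: hp => /= /andP[vu hp]; exists u => //.
case: ex_minnP => l _ /(_ (size p)) lmin.
apply: (@leq_ltn_trans (size p)); last by rewrite -sp.
by apply: lmin; apply/asboolP; exists p.
Qed.

(* Two distinct neighbours of [v] that can both descend to the cycle without
   meeting [v] would close a second cycle. *)
Lemma parent_unique : exists d : V -> nat, forall v u1 u2, v \notin C ->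
  adj D v u1 -> adj D v u2 -> (u1 \in C) || (d u1 <= d v) ->
  (u2 \in C) || (d u2 <= d v) -> u1 = u2.
Proof.
have [d hd] := dist_to_cycle; exists d => v u1 u2 vC a1 a2 h1 h2.
have [c0 c0C] : exists c, c \in C.
  by case: C C_size => // c ? _; exists c; rewrite mem_head.
(* From the first step of the descent on, [d] is below [d v], so the path misses [v] until it
   reaches [C]; there it can follow [C], which does not contain [v]. *)
have desc u : u != v -> (u \in C) || (d u <= d v) -> connect (avoid v) u c0.
  have [k] := ubnP (d u); elim: k u => // k IH u duk uv.
  case: (boolP (u \in C)) => [uC _|uC /= duv].
    exact: connect_avoid_in_cycle.
  have [z uz dz] := hd _ uC.
  have zv : z != v by apply: contraTneq dz => ->; rewrite -leqNgt.
  apply: (@connect_trans _ _ z); first by apply: connect1; apply/and3P.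
  apply: IH => //; first exact: leq_trans dz duk.
  by rewrite (leq_trans (ltnW dz) duv) orbT.
have avoidC : connect_sym (avoid v).
  apply: sym_connect_sym => x y; rewrite /avoid adjC; congr (_ && _).
  by rewrite andbC.
apply/eqP; apply: contraNT vC => n12.
apply: (mem_cycle_of_avoiding_path n12 a1 a2).
apply: (@connect_trans _ _ c0); first by apply: desc => //; rewrite eq_sym adj_neq.
by rewrite avoidC; apply: desc => //; rewrite eq_sym adj_neq.
Qed.

End OddUnicyclic.

(** * Min-max theorem for vertex covers and packings of edges and odd cycles *)

Section Packing.
Local Open Scope nat_scope.
Variables (V : finType) (D : wograph V).
Implicit Types (x y u v : V) (b : V -> nat) (W : {set V}) (E : seq (V * V)).

Definition vertex_cover W : Prop :=
  forall x y, adj D x y -> (x \in W) || (y \in W).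

(** The edges of a packing form a multiset: [E] may repeat an edge and may list it in either
    orientation. *)
Definition edge_list E : bool := all (fun p => adj D p.1 p.2) E.

Definition mult E v : nat := \sum_(p <- E) ((p.1 == v) + (p.2 == v)).

Lemma mult_cat E1 E2 v : mult (E1 ++ E2) v = mult E1 v + mult E2 v.
Proof. exact: big_cat. Qed.

Lemma mult_cons p E v : mult (p :: E) v = (p.1 == v) + (p.2 == v) + mult E v.
Proof. exact: big_cons. Qed.

Lemma mult_nil v : mult [::] v = 0.
Proof. exact: big_nil. Qed.

Lemma sum_pred1 (W : {set V}) x : \sum_(v in W) (x == v) = (x \in W).
Proof.
case: (boolP (x \in W)) => xW.
  rewrite (bigD1 x) //= eqxx big1 // => v /andP[_ /negPf].
  by rewrite eq_sym => ->.
by rewrite big1 // => v vW; case: eqP => // E; rewrite E vW in xW.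
Qed.

(** Weak duality for edges: each member of [E] has an end in [W]. *)
Lemma cover_mult W E : vertex_cover W -> edge_list E ->
  size E <= \sum_(v in W) mult E v.
Proof.
move=> hW; elim: E => [|[x y] E IH] //= /andP[xy hE].
under eq_bigr => v _ do rewrite mult_cons /=.
rewrite big_split /= big_split /= !sum_pred1; have := IH hE.
by have := hW _ _ xy; case: (x \in W); case: (y \in W) => //= _; lia.
Qed.

Lemma sum_mult E : \sum_v mult E v = 2 * size E.
Proof.
elim: E => [|[x y] E IH]; first by rewrite big1 // => v _; rewrite mult_nil.
under eq_bigr => v _ do rewrite mult_cons /=.
rewrite !big_split /= IH.
have S (z : V) : \sum_v (z == v) = 1.
  have := sum_pred1 [set: V] z; rewrite in_setT => E1.
  by apply: etrans E1; apply: eq_bigl => v; rewrite in_setT.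
by rewrite !S; lia.
Qed.

(* Whether a set covers only matters on the support of the weight: the vertices
   of weight zero can be added for free. *)
Lemma cover_of_support b W :
  (forall x y, adj D x y -> 0 < b x -> 0 < b y -> (x \in W) || (y \in W)) ->
  exists W', [/\ vertex_cover W', W \subset W' &
    \sum_(v in W') b v = \sum_(v in W) b v].
Proof.
move=> hW; exists (W :|: [set v | b v == 0]); split.
- move=> x y xy; rewrite !inE.
  case: (posnP (b x)) => [_|bx]; first by rewrite orbT.
  case: (posnP (b y)) => [_|by_]; first by rewrite !orbT.
  by rewrite !orbF hW.
- exact: subsetUl.
rewrite (bigID (mem W)) /= [X in _ + X]big1 ?addn0; last first.
  by move=> v /andP[]; rewrite !inE => /orP[->|/eqP].
by apply: eq_bigl => v; rewrite !inE; case: (v \in W); rewrite ?andbF.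
Qed.

Variable C : seq V.
Hypothesis hC : unicyclic_with_cycle D C.
Variable n : nat.
Hypothesis hsize : size C = 2 * n + 1.

Let C_cycle : cycle (adj D) C. Proof. by case: hC => _ [_ /andP[]]. Qed.
Let C_uniq : uniq C. Proof. by case: hC => _ [_ /andP[]]. Qed.
Let C_size : 2 < size C. Proof. by case: hC => _ []. Qed.
Let f := next C.

Let f_mem v : v \in C -> f v \in C. Proof. by rewrite mem_next. Qed.
Let f_adj v : v \in C -> adj D v (f v). Proof. exact: next_cycle. Qed.
Let iter_mem k v : v \in C -> iter k f v \in C.
Proof. by move=> vC; elim: k => //= k; exact: f_mem. Qed.
Let f_fcycle : fcycle f C. Proof. exact: cycle_next. Qed.
Let f_iter_size v : v \in C -> iter (2 * n + 1) f v = v.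
Proof.
by move=> vC; rewrite -hsize -(order_cycle f_fcycle C_uniq vC) (iter_order_cycle f_fcycle).
Qed.
Let f_reach u v : u \in C -> v \in C -> exists k, v = iter k f u.
Proof.
move=> uC vC; have : fconnect f u v by rewrite (fconnect_cycle f_fcycle).
by move/iter_findex <-; eexists.
Qed.
Let ff_neq v : v \in C -> f (f v) != v.
Proof.
move=> vC; apply/eqP => E.
have : order f v = 2 * n + 1 by rewrite (order_cycle f_fcycle).
suff : order f v <= 2 by move: C_size; lia.
have -> : order f v = #|fconnect f v| by [].
apply: (@leq_trans #|[set v; f v]|); last by rewrite cards2; case: eqP.
apply: subset_leq_card; apply/subsetP => w; rewrite unfold_in => /iter_findex <-.
elim: (findex _ _ _) => [|k]; rewrite ?set21 //= !inE => /orP[] /eqP ->.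
  by rewrite eqxx orbT.
by rewrite E eqxx.
Qed.
Let f_inj : injective f. Proof. exact: can_inj (prev_next C_uniq). Qed.

(** For [v] on [C] the vertices summed are [f v], [f^3 v], ..., [f^(2n+1) v = v]: the alternating
    cover of the odd cycle that contains both ends of the edge from [v] to [f v]. *)
Let odd_sum b v := \sum_(k < n.+1) b (iter (2 * k).+1 f v).

(** Moving the base point two steps replaces [f v] by [f (f v)] and keeps the other summands. *)
Let odd_sum_step b v : v \in C ->
  odd_sum b (f (f v)) + b (f v) = odd_sum b v + b (f (f v)).
Proof.
move=> vC; rewrite /odd_sum big_ord_recr big_ord_recl.
have -> : iter (2 * @ord_max n).+1 f (f (f v)) = f (f v).
  by rewrite iterS -!iterSr -[v in RHS](f_iter_size vC) -!iterS; congr (iter _ f v) => /=; lia.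
have -> : \sum_(i < n) b (iter (2 * widen_ord (leqnSn n) i).+1 f (f (f v))) =
  \sum_(i < n) b (iter (2 * lift ord0 i).+1 f v).
  apply: eq_bigr => i _; rewrite -!iterSr; congr (b (iter _ f v)).
  by rewrite lift0 /=; lia.
by rewrite [iter _ _ _ in RHS]/= [_ + b (f v)]addnC addnA.
Qed.

(* If the weights on the cycle are not all equal, an edge [(v, f v)] with
   [odd_sum b v] maximal lies in no cover of minimal weight: otherwise trading
   [f v] for [f (f v)] moves the pair two steps along the odd cycle, for ever. *)
Let exists_loose_edge s b :
  (forall v, (0 < b v) = (v \in C)) ->
  (forall W, vertex_cover W -> s <= \sum_(v in W) b v) ->
  (exists k, forall v, v \in C -> b v = k) \/
  exists2 v, v \in C & forall W, vertex_cover W -> v \in W -> f v \in W ->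
     s < \sum_(v in W) b v.
Proof.
move=> bC hs.
have [c0 c0C] : exists c, c \in C.
  by case: C C_size => // c ? _; exists c; rewrite mem_head.
have [v vC vmax] : exists2 v, v \in C & forall u, u \in C -> odd_sum b u <= odd_sum b v.
  by case: (arg_maxnP (odd_sum b) c0C) => v vC vmax; exists v => // u /vmax.
case: (pselect (forall W, vertex_cover W -> v \in W -> f v \in W ->
   s < \sum_(u in W) b u)) => [H|H]; first by right; exists v.
left.
pose P u := [/\ u \in C, odd_sum b u = odd_sum b v & exists W,
  [/\ vertex_cover W, u \in W, f u \in W & \sum_(u in W) b u <= s]].
have Pv : P v.
  split => //; apply: contra_notP H => H W cW vW fW; rewrite ltnNge.
  by apply/negP => le; apply: H; exists W.
have Pstep u : P u -> P (f (f u)).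
  move=> [uC eu [W [cW uW fuW leW]]].
  have fuC := f_mem uC; have ffuC := f_mem fuC.
  have := odd_sum_step b uC; have := vmax _ ffuC; rewrite -eu => le1 st.
  pose W1 := (W :\ f u) :|: [set f (f u)].
  have sW : \sum_(w in W) b w = b (f u) + \sum_(w in W :\ f u) b w.
    by rewrite (big_setD1 (f u)).
  (* On the cycle [f u] is adjacent only to [u], which stays in [W1], and to [f (f u)], which is
     added. *)
  have cover1 x y : adj D x y -> 0 < b x -> 0 < b y -> (x \in W1) || (y \in W1).
    rewrite !bC => xy xC yC.
    wlog E : x y xy xC yC / y = f x.
      move=> Hw; have [|] := cycle_chordless hC xC yC xy => E; first exact: Hw.
      by rewrite orbC; apply: Hw => //; rewrite adjC.
    rewrite E !inE.
    case: (eqVneq x (f u)) => [->|nx] /=; first by rewrite eqxx !orbT.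
    case: (eqVneq (f x) (f u)) => [/f_inj ->|nfx] /=; first by rewrite uW.
    by have := cW _ _ xy; rewrite E => /orP[] -> //; rewrite !orbT.
  have [W2 [cW2 sW2 eW2]] := cover_of_support cover1.
  have := hs _ cW2; rewrite eW2.
  (* If [f (f u)] was already in [W], then [W1] is lighter than [W] by [b (f u) > 0] and weighs less
     than [s], contrary to [hs]. *)
  case: (boolP (f (f u) \in W :\ f u)) => ffW.
    have -> : W1 = W :\ f u by apply/setUidPl; rewrite sub1set.
    move/(leq_trans leW); rewrite sW -[X in _ <= X]add0n leq_add2r leqn0.
    by rewrite -[_ == _]negbK -lt0n bC fuC.
  have eW1 : \sum_(w in W1) b w = b (f (f u)) + \sum_(w in W :\ f u) b w.
    by rewrite /W1 setUC big_setU1.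
  rewrite eW1 => le2.
  (* Minimality of [W] gives one inequality and maximality of [odd_sum b u] the other, so the trade
     changes neither quantity and [P] is passed on. *)
  have le3 : b (f u) <= b (f (f u)).
    by rewrite -(leq_add2r (\sum_(w in W :\ f u) b w)) -sW (leq_trans leW).
  have le4 : b (f (f u)) <= b (f u).
    by rewrite -(leq_add2l (odd_sum b u)) -st leq_add2r.
  have eb : b (f (f u)) = b (f u) by apply/eqP; rewrite eqn_leq le4.
  split => //; first by move: st; rewrite eb => /addIn ->.
  exists W2; split => //.
  - by apply: (subsetP sW2); rewrite !inE eqxx orbT.
  - apply: (subsetP sW2).
    have ffnW : f (f u) \notin W.
      by move: ffW; rewrite !inE -[f (f u) == _]negbK eq_sym (adj_neq (f_adj _)).
    have := cW _ _ (f_adj ffuC); rewrite (negPf ffnW) /= => fffW.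
    by rewrite !inE fffW ff_neq.
  - by rewrite eW2 eW1 eb -sW.
have Pall u : u \in C -> odd_sum b u = odd_sum b v.
  move=> uC.
  have Piter k : P (iter (2 * k) f v).
    elim: k => [|k IH]; first exact: Pv.
    by have := Pstep _ IH; rewrite -!iterS; congr (P (iter _ f v)); lia.
  have [k ->] := f_reach vC uC.
  (* For odd [k] one additional turn around the cycle, of odd length [2 * n + 1], makes the number
     of steps even. *)
  case: (boolP (odd k)) => ok.
    rewrite -(f_iter_size vC) -iterD.
    have [_ + _] := Piter (n + (k./2).+1); rewrite f_iter_size //.
    congr (odd_sum b (iter _ f v) = _).
    have := odd_double_half k; lia.
  have [_ + _] := Piter k./2; congr (odd_sum b (iter _ f v) = _).
  have := odd_double_half k; lia.
have bconst u : u \in C -> b (f (f u)) = b (f u).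
  move=> uC; have := odd_sum_step b uC; rewrite !Pall ?f_mem //; lia.
exists (b v) => u uC; have [k ->] := f_reach vC uC.
elim: k => //= k IH.
(* This is the predecessor of [f^k v] on the cycle, so [bconst] compares [f^k v] with
   [f^(k+1) v]. *)
have wC : iter (2 * n + k) f v \in C by exact: iter_mem.
have := bconst _ wC; rewrite -!iterS.
have -> : (2 * n + k).+2 = k.+1 + (2 * n + 1) by lia.
have -> : (2 * n + k).+1 = k + (2 * n + 1) by lia.
by rewrite (iterD k.+1) (iterD k) !f_iter_size // IH.
Qed.

Let drop_edge x y b v := b v - ((x == v) + (y == v)).

Let drop_edge_sum x y b W : adj D x y -> 0 < b x -> 0 < b y ->
  \sum_(v in W) b v =
  \sum_(v in W) drop_edge x y b v + (x \in W) + (y \in W).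
Proof.
move=> xy bx by_; rewrite -addnA -!sum_pred1 -!big_split; apply: eq_bigr => v _.
rewrite /= /drop_edge subnK //; case: (eqVneq x v) => [<-|_].
  by rewrite eq_sym (negPf (adj_neq xy)).
by case: (eqVneq y v) => [<-|_].
Qed.

(** A support vertex off [C] at maximal distance has at most one neighbour in the support, by
    [parent_unique]. If the support lies in [C] but is not closed under [f], a vertex whose
    successor is missing can only keep its predecessor. Otherwise the support is empty or all of
    [C]. *)
Let leaf_or_cycle b : [\/ exists2 v, 0 < b v & forall u1 u2, adj D v u1 ->
    adj D v u2 -> 0 < b u1 -> 0 < b u2 -> u1 = u2,
  forall v, b v = 0 | forall v, (0 < b v) = (v \in C)].
Proof.
have [d hd] := parent_unique hC.
case: (pickP [pred v | (0 < b v) && (v \notin C)]) => [v0 hv0|bC].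
  apply: Or31; case: (arg_maxnP d hv0) => v /andP[bv vC] vmax.
  have near u : 0 < b u -> (u \in C) || (d u <= d v).
    by move=> bu; case: (boolP (u \in C)) => //= uC; apply: vmax; rewrite /= bu.
  by exists v => // u1 u2 a1 a2 b1 b2; apply: (hd v) => //; exact: near.
have {}bC v : 0 < b v -> v \in C.
  by move=> bv; have := bC v; rewrite /= bv => /negbFE.
case: (pickP [pred v | (0 < b v) && (b (f v) == 0)]) => [v /andP[bv bfv]|bf].
  apply: Or31; exists v => // u1 u2 a1 a2 b1 b2; apply: f_inj.
  have pv u : adj D v u -> 0 < b u -> f u = v.
    move=> vu bu; have [E|->//] := cycle_chordless hC (bC _ bv) (bC _ bu) vu.
    by move: bu; rewrite E (eqP bfv).
  by rewrite !pv.
have {}bf v : 0 < b v -> 0 < b (f v).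
  by move=> bv; have := bf v; rewrite /= bv lt0n => /negbT.
case: (pickP [pred v | 0 < b v]) => [v0 /= bv0|b0].
  apply: Or33 => v; apply/idP/idP => [|vC]; first exact: bC.
  have [k ->] := f_reach (bC _ bv0) vC.
  by elim: k => //= k; exact: bf.
by apply: Or32 => v; have /= := b0 v; case: (b v).
Qed.

(** Every second vertex of the odd cycle, beginning and ending around [c0], together with all
    vertices off the cycle. *)
Let half_cover : exists W, vertex_cover W /\ #|[set v in W | v \in C]| <= n + 1.
Proof.
have [c0 c0C] : exists c, c \in C.
  by case: C C_size => // c ? _; exists c; rewrite mem_head.
pose S := [set iter (2 * (k : nat)).+1 f c0 | k : 'I_n.+1].
have hS k : odd k -> k <= 2 * n + 1 -> iter k f c0 \in S.
  move=> ok lek; have lt : k./2 < n.+1 by have := odd_double_half k; lia.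
  apply/imsetP; exists (Ordinal lt) => //.
  by congr (iter _ f c0) => /=; have := odd_double_half k; lia.
have cS x : x \in C -> (x \in S) || (f x \in S).
  move=> xC; have : fconnect f c0 x by rewrite (fconnect_cycle f_fcycle).
  move=> cx; have lt := findex_max cx; rewrite (order_cycle f_fcycle) // hsize in lt.
  rewrite -(iter_findex cx) -iterS; set k := findex _ _ _ in lt *.
  case: (boolP (odd k)) => ok; first by rewrite hS //; lia.
  by rewrite orbC hS //=; lia.
exists (S :|: [set v | v \notin C]); split.
  move=> x y xy; rewrite !inE.
  case: (boolP (x \in C)) => xC; last by rewrite orbT.
  case: (boolP (y \in C)) => yC; last by rewrite !orbT.
  by rewrite !orbF; have [->|->] := cycle_chordless hC xC yC xy;
    [| rewrite orbC]; exact: cS.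
apply: (@leq_trans #|S|); last by rewrite addn1 -[n.+1]card_ord leq_imset_card.
apply: subset_leq_card; apply/subsetP => v; rewrite !inE.
by case: (v \in C); rewrite ?andbF // orbF andbT.
Qed.

Theorem cover_packing s b :
  (forall W, vertex_cover W -> s <= \sum_(v in W) b v) ->
  exists E t, [/\ edge_list E, s <= size E + t * (n + 1) &
    forall v, mult E v + t * (v \in C) <= b v].
Proof.
have [N] := ubnP (\sum_v b v); elim: N s b => // N IH s b bN hs.
(* An edge may be peeled off as soon as every cover still weighs at least [s - 1] afterwards; it
   then supplies one edge of the packing. *)
have peel x y : adj D x y -> 0 < b x -> 0 < b y ->
    (forall W, vertex_cover W -> s <= (\sum_(v in W) drop_edge x y b v).+1) ->
    exists E t, [/\ edge_list E, s <= size E + t * (n + 1) &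
      forall v, mult E v + t * (v \in C) <= b v].
  move=> xy bx by_ hs'.
  have [||E [t [hE sE mE]]] := IH s.-1 (drop_edge x y b).
  - have := drop_edge_sum [set: V] xy bx by_; rewrite !inE /=.
    have e g : \sum_(v in [set: V]) g v = \sum_v g v :> nat.
      by apply: eq_bigl => v; rewrite inE.
    by rewrite !e; lia.
  - by move=> W /hs'; lia.
  exists ((x, y) :: E), t; split => /=; [by rewrite xy | lia |] => v.
  rewrite mult_cons /=; have := mE v; rewrite /drop_edge.
  have : (x == v) + (y == v) <= b v.
    case: (eqVneq x v) => [<-|_]; first by rewrite eq_sym (negPf (adj_neq xy)).
    by case: (eqVneq y v) => [<-|_].
  by move=> kb; rewrite leq_subRL // !addnA.
case: (leaf_or_cycle b) => [[v bv leaf]|b0|bC].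
- case: (pickP [pred u | adj D v u && (0 < b u)]) => [u /andP[vu bu]|iso].
    apply: (peel v u) => // W cW.
    have := drop_edge_sum W vu bv bu.
    case: (boolP (v \in W)) => vW; last first.
      by have := hs _ cW; case: (u \in W) => /=; lia.
    case: (boolP (u \in W)) => uW /=; last by have := hs _ cW; lia.
    (* A cover containing both ends loses two. But [u] is the only neighbour of [v] in the support,
       so [W] without [v] still covers the support and weighs at least [s]; hence [W] weighs more
       than [s]. *)
    rewrite (big_setD1 v) //=.
    have [|W1 [cW1 _ eW1]] := @cover_of_support b (W :\ v).
      move=> x y xy bx by_.
      wlog E : x y xy bx by_ / v = x => [Hw|].
        case: (eqVneq v x) => [E|nx]; first exact: Hw.
        case: (eqVneq v y) => [E|ny].
          by rewrite orbC; apply: Hw => //; rewrite adjC.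
        by have := cW _ _ xy; rewrite !inE ![_ == v]eq_sym nx ny.
      rewrite -E in xy *; have -> : y = u by exact: leaf.
      by rewrite !inE uW eq_sym (adj_neq vu) orbT.
    have := hs _ cW1; rewrite eW1; lia.
  (* Here [v] is isolated in the support, so any cover can do without it, and a unit of its weight
     is discarded with [s] unchanged. *)
  pose b' w := b w - (v == w).
  have eb W : \sum_(w in W) b w = \sum_(w in W) b' w + (v \in W).
    rewrite -sum_pred1 -big_split; apply: eq_bigr => w _.
    by rewrite /= subnK //; case: eqP => // <-.
  have [||E [t [hE sE mE]]] := IH s b'.
  - have := eb [set: V]; rewrite inE /=.
    have e g : \sum_(w in [set: V]) g w = \sum_w g w :> nat.
      by apply: eq_bigl => w; rewrite inE.
    by rewrite !e; lia.
  - move=> W cW; case: (boolP (v \in W)) => vW; last first.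
      by have := hs _ cW; rewrite eb (negPf vW) addn0.
    have [|W1 [cW1 _ eW1]] := @cover_of_support b (W :\ v).
      move=> x y xy bx by_; have := cW _ _ xy; rewrite !inE.
      have -> : x != v.
        by apply: contraTneq xy => ->; have /= := iso y; rewrite by_ andbT => ->.
      have -> // : y != v.
      apply: contraTneq xy => ->.
      by have /= := iso x; rewrite bx andbT adjC => ->.
    have := hs _ cW1; rewrite eW1 eb setD11 addn0 => /leq_trans; apply.
    by rewrite [X in _ <= X](big_setD1 v) //= leq_addl.
  exists E, t; split => // w; apply: (leq_trans (mE w)); exact: leq_subr.
- exists [::], 0; split => // [|v]; last by rewrite mult_nil.
  have /hs : vertex_cover [set: V] by move=> x y _; rewrite inE.
  by rewrite big1.
case: (exists_loose_edge bC hs) => [[k bk]|[v vC loose]].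
  (* A constant weight [k] is packed by [k] copies of the cycle, of value [k * (n + 1)];
     [half_cover] shows that [s] does not exceed this value. *)
  exists [::], k; split => // [|v]; last first.
    rewrite mult_nil; case: (boolP (v \in C)) => vC; last by rewrite muln0.
    by rewrite bk ?muln1.
  have [W [cW sW]] := half_cover.
  apply: (leq_trans (hs _ cW)).
  rewrite (bigID (mem C)) /= [X in _ + X]big1 ?addn0; last first.
    by move=> v /andP[_]; rewrite -bC lt0n negbK => /eqP.
  have -> : \sum_(v in W | v \in C) b v = \sum_(v in [set v in W | v \in C]) k.
    rewrite [LHS]big_mkcond [RHS]big_mkcond; apply: eq_bigr => v _; rewrite inE.
    by case: ifP => // /andP[_ /bk].
  by rewrite sum_nat_const mulnC leq_mul2l sW orbT.
apply: (peel v (f v)) => //; rewrite ?f_adj ?bC ?f_mem // => W cW.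
have bv : 0 < b v by rewrite bC.
have bfv : 0 < b (f v) by rewrite bC f_mem.
have := drop_edge_sum W (f_adj vC) bv bfv.
have := hs _ cW; have := loose _ cW.
by case: (v \in W); case: (f v \in W) => //= l1 l2 l3; try (have := l1 isT isT); lia.
Qed.

Let pairs := fix pairs (l : seq V) : seq (V * V) :=
  if l is x :: y :: l' then (x, y) :: pairs l' else [::].

Let pairs_spec k l x0 : size l = 2 * k -> path (adj D) x0 l ->
  [/\ edge_list (pairs l), size (pairs l) = k &
      forall v, mult (pairs l) v = count_mem v l].
Proof.
elim: k l x0 => [|k IH] [|x [|y l]] x0 //=; try lia.
  by split => // v; rewrite mult_nil.
move=> sl /and3P[_ xy hl]; have [||h1 h2 h3] := IH l y => //; first lia.
split => [|/=|v]; [by rewrite /= xy | by rewrite h2 | ].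
by rewrite mult_cons h3 /= addnA.
Qed.

(** Without its first vertex the cycle is a path on [2 * n] vertices, whose consecutive pairs form a
    matching. *)
Lemma cycle_matching : exists E, [/\ edge_list E, size E = n &
  forall v, mult E v <= (v \in C)].
Proof.
move: hsize C_cycle C_uniq; case EC: C => [|c l] //=; first lia.
rewrite rcons_path => sl /andP[hl _] /andP[cl ul].
have [|h1 h2 h3] := @pairs_spec n l c _ hl; first lia.
exists (pairs l); split => // v; rewrite h3 count_uniq_mem // inE.
by case: (v \in l); rewrite ?orbT.
Qed.

(** Each of the [2 * n + 1] cycle edges meets [W], and each vertex lies on two of them. *)
Lemma cover_cycle W : vertex_cover W -> n < #|[set v in W | v \in C]|.
Proof.
move=> cW.
have e1 (g : V -> nat) : \sum_(v in [set v in C]) g v = \sum_(v <- C) g v.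
  by rewrite big_uniq //; apply: eq_bigl => v; rewrite inE.
have eW : #|[set v in W | v \in C]| = \sum_(v in [set v in C]) (v \in W).
  rewrite -sum1_card big_mkcond [RHS]big_mkcond; apply: eq_bigr => v _.
  by rewrite !inE; case: (v \in W); case: (v \in C).
have eW' : #|[set v in W | v \in C]| = \sum_(v in [set v in C]) (f v \in W).
  rewrite eW (reindex_inj f_inj); apply: eq_bigl => v.
  by rewrite !inE mem_next.
have : size C <= \sum_(v in [set v in C]) ((v \in W) + (f v \in W)).
  rewrite e1 -sum1_size big_seq [X in _ <= X]big_seq leq_sum // => v vC.
  by have := cW _ _ (f_adj vC); case: (v \in W); case: (f v \in W).
rewrite big_split -eW -eW' hsize /=; lia.
Qed.

Lemma mult_take k E v : mult (take k E) v <= mult E v.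
Proof. by rewrite -{2}(cat_take_drop k E) mult_cat leq_addr. Qed.

(** The numbers are made exact: surplus edges are dropped, and if there are more than [s %/ (n + 1)]
    cycles, one surplus cycle is broken into a matching that supplies the at most [n] missing edges.
    Conversely, a cover meets each packed edge at least once and each packed cycle in at least
    [n + 1] vertices. *)
Theorem cover_packing_iff s b :
  (forall W, vertex_cover W -> s <= \sum_(v in W) b v) <->
  exists E t, [/\ t <= s %/ (n + 1), edge_list E, size E = s - t * (n + 1) &
    forall v, mult E v + t * (v \in C) <= b v].
Proof.
split => [/cover_packing[E [t [hE sE mE]]]|[E [t [ts hE sE mE]]] W cW].
  have all_take k (E1 : seq (V * V)) : edge_list E1 -> edge_list (take k E1).
    by rewrite -{1}(cat_take_drop k E1) /edge_list all_cat => /andP[].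
  case: (leqP t (s %/ (n + 1))) => ht.
    exists (take (s - t * (n + 1)) E), t; split => //; first exact: all_take.
      by rewrite size_takel //; lia.
    by move=> v; apply: leq_trans (mE v); rewrite leq_add2r mult_take.
  have [M [hM sM mM]] := cycle_matching.
  set k := s %/ (n + 1) in ht *.
  exists (take (s - k * (n + 1)) M), k; split => //; first exact: all_take.
    rewrite size_takel // sM.
    have := divn_eq s (n + 1); have := @ltn_pmod s (n + 1); rewrite -/k; lia.
  move=> v; apply: leq_trans (mE v).
  apply: (@leq_trans (t * (v \in C))); last exact: leq_addl.
  apply: (@leq_trans ((v \in C) + k * (v \in C))).
    by rewrite leq_add2r (leq_trans (mult_take _ _ _)).
  by rewrite -mulSn leq_mul2r ht orbT.
apply: (@leq_trans (\sum_(v in W) (mult E v + t * (v \in C)))); last exact: leq_sum.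
rewrite big_split -big_distrr /=.
have := cover_mult cW hE; have := cover_cycle cW.
have -> : #|[set v in W | v \in C]| = \sum_(v in W) (v \in C).
  rewrite -sum1_card big_mkcond [RHS]big_mkcond; apply: eq_bigr => v _.
  by rewrite !inE; case: (v \in W); case: (v \in C).
rewrite sE => h1 h2.
have : t * (n + 1) <= t * \sum_(v in W) (v \in C) by rewrite leq_mul2l addn1 h1 orbT.
by move/(leq_add h2); apply: leq_trans; rewrite addnC -leq_subLR.
Qed.

(** If every cycle edge met the independent set [P], the complement of [P] and the complement of the
    part of [C] outside [P] would both be covers. They would split [C] into two parts of at least
    [n + 1] vertices each, which is one vertex too many. *)
Lemma cycle_edge_off (P : {pred V}) :
  (forall x y, adj D x y -> x \in P -> y \notin P) ->
  exists x y, [/\ adj D x y, x \in C, y \in C, x \notin P & y \notin P].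
Proof.
move=> hP.
have cW : vertex_cover [set v | v \notin P].
  by move=> x y /hP; rewrite !inE; case: (x \in P) => //= ->.
have [x] : exists x, (x \in C) && ((x \notin P) && (f x \notin P)).
  apply/existsP; apply: contraPT (cover_cycle cW) => /existsPn H; apply/negP.
  rewrite -leqNgt.
  have cW' : vertex_cover (~: [set v in C | v \notin P]).
    move=> x y xy; rewrite !inE -negb_and; apply/negP => /andP[/andP[xC xP] /andP[yC yP]].
    have [E|E] := cycle_chordless hC xC yC xy.
      by have := H x; rewrite xC xP /f -E yP.
    by have := H y; rewrite yC yP /f -E xP.
  have := cover_cycle cW'.
  have : #|[set v in [set v0 | v0 \notin P] | v \in C]| +
         #|[set v in ~: [set v0 in C | v0 \notin P] | v \in C]| = size C.
    rewrite -(card_uniqP C_uniq) -[#|C|]cardsE.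
    rewrite -(cardsID [set v | v \notin P] [set x in C]).
    by congr (_ + _); apply: eq_card => v; rewrite !inE;
      case: (v \in C); case: (v \in P).
  rewrite hsize; lia.
by move=> /and3P[xC xP fxP]; exists x, (f x); split => //; [exact: f_adj | exact: f_mem].
Qed.

End Packing.

From mathcomp Require Import all_order all_algebra mpoly.
From mathcomp Require Import classical_sets reals topology normedtype.
From mathcomp Require Import sequences.

Import Order.TTheory GRing.Theory Num.Theory.
Import numFieldNormedType.Exports.

Local Open Scope classical_set_scope.
Local Open Scope ring_scope.

(** * Ideals and contraction from a localization *)

Section IdealTheory.
Variable R : idomainType.
Implicit Types (I J p : set R) (G : set R).

Lemma ideal_sum I (T : Type) (r : seq T) (Q : pred T) (F : T -> R) :
  is_ideal I -> (forall i, Q i -> I (F i)) -> I (\sum_(i <- r | Q i) F i).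
Proof. by case=> I0 ID _ h; elim/big_ind: _. Qed.

Lemma ideal_gen_ideal G : is_ideal (ideal_gen G).
Proof.
split.
- exists 0, (fun _ => 0), (fun _ => 0); split => //; last by rewrite big_ord0.
  by case.
- move=> _ _ [m1 [a1 [g1 [_ G1 ->]]]] [m2 [a2 [g2 [_ G2 ->]]]].
  exists (m1 + m2)%N, (fun i => match split i with inl j => a1 j | inr j => a2 j end),
    (fun i => match split i with inl j => g1 j | inr j => g2 j end); split => //.
    by move=> i; case: (split i).
  rewrite big_split_ord /=; congr (_ + _); apply: eq_bigr => i _.
    by rewrite -[lshift m2 i]/(unsplit (inl i)) unsplitK.
  by rewrite -[rshift m1 i]/(unsplit (inr i)) unsplitK.
- move=> c _ [m [a [g [_ Gg ->]]]]; exists m, (fun i => c * a i), g; split => //.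
  by rewrite mulr_sumr; apply: eq_bigr => i _; rewrite mulrA.
Qed.

Lemma sub_ideal_gen G : G `<=` ideal_gen G.
Proof.
move=> g Gg; exists 1%N, (fun _ => 1), (fun _ => g); split => //.
by rewrite big_ord1 mul1r.
Qed.

Lemma ideal_gen_min G I : is_ideal I -> G `<=` I -> ideal_gen G `<=` I.
Proof.
move=> idI GI _ [m [a [g [_ Gg ->]]]]; apply: ideal_sum => // i _.
by case: idI => _ _; apply; apply: GI.
Qed.

Lemma ideal_add_ideal I J : is_ideal I -> is_ideal J -> is_ideal (ideal_add I J).
Proof.
move=> [I0 ID IM] [J0 JD JM]; split.
- by exists 0 => //; exists 0 => //; rewrite addr0.
- move=> _ _ [a1 Ia1 [b1 Jb1 <-]] [a2 Ia2 [b2 Jb2 <-]].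
  exists (a1 + a2); first exact: ID.
  by exists (b1 + b2); [exact: JD | rewrite addrACA].
- move=> c _ [a Ia [b Jb <-]]; exists (c * a); first exact: IM.
  by exists (c * b); [exact: JM | rewrite mulrDr].
Qed.

Lemma prime_exp p (x : R) k : is_prime_ideal p -> ~ p x -> ~ p (x ^+ k).
Proof.
move=> [_ p1 pM] px; elim: k => [|k IH]; first by rewrite expr0.
by rewrite exprS => /pM[].
Qed.

Lemma loc_contractP p J f : is_prime_ideal p -> is_ideal J ->
  loc_contract p J f <-> exists2 u, ~ p u & J (u * f).
Proof.
move=> pp [J0 JD JM]; have [[p0 _ _] p1 pM] := pp.
have nz s : ~ p s -> s != 0 by apply: contra_notN => /eqP ->.
split; last first.
  move=> [u pu Juf]; exists 1%N, (fun _ => tofrac 1 / tofrac u), (fun _ => tofrac (u * f)).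
  split.
  - by move=> _; exists 1, u.
  - by move=> _; exists (u * f).
  - by rewrite big_ord1 rmorphM mulrA rmorph1 mul1r mulVf ?mul1r // tofrac_eq0 nz.
move=> [m [a [g [ha hg E]]]].
(* [H z] says that [z] is a fraction with numerator in [J] and denominator outside [p]; common
   denominators show that it is stable under sums. *)
pose H (z : {fraction R}) := exists u r, [/\ ~ p u, J r & z * tofrac u = tofrac r].
have : H (tofrac f).
  rewrite E; elim/big_ind: _ => [|x y|i _].
  - by exists 1, 0; rewrite mul0r rmorph0.
  - move=> [u1 [r1 [pu1 J1 E1]]] [u2 [r2 [pu2 J2 E2]]].
    exists (u1 * u2), (u2 * r1 + u1 * r2); split.
    + by move=> /pM[].
    + by apply: JD; apply: JM.
    + rewrite tofracD !tofracM -E1 -E2 mulrDl; congr (_ + _).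
        by rewrite mulrA mulrC.
      by rewrite mulrCA.
  - have [x [s [ps ->]]] := ha i; have [y Jy <-] := hg i.
    exists s, (x * y); split; [by [] | exact: JM |].
    by rewrite mulrAC divfK ?tofrac_eq0 ?nz // rmorphM.
move=> [u [r [pu Jr]]]; rewrite -rmorphM => /eqP; rewrite tofrac_eq => /eqP E'.
by exists u => //; rewrite mulrC E'.
Qed.

End IdealTheory.

(** * Monomial ideals given by predicates on exponents *)

Section MonomialIdeals.
Variables (N : nat) (K : fieldType).
Implicit Types (P Q : 'X_{1..N} -> Prop) (m : 'X_{1..N}) (f u : {mpoly K[N]}).

Definition mon_ideal P : set {mpoly K[N]} :=
  [set f | forall m, m \in msupp f -> P m].

Definition up_closed P : Prop := forall m m', P m -> P (m + m')%MM.

Lemma mon_ideal_ideal P : up_closed P -> is_ideal (mon_ideal P).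
Proof.
move=> uP; split.
- by move=> m; rewrite msupp0.
- by move=> f g hf hg m /msuppD_le; rewrite mem_cat => /orP[/hf|/hg].
- move=> f g hg m /msuppM_le /allpairsP[[m1 m2] /= [_ /hg P2 ->]].
  by rewrite addmC; exact: uP.
Qed.

Lemma mon_idealX P m : mon_ideal P 'X_[m] <-> P m.
Proof.
split; first by apply; rewrite msuppX mem_head.
by move=> Pm m'; rewrite msuppX inE => /eqP ->.
Qed.

Lemma mon_ideal_min P (J : set {mpoly K[N]}) : is_ideal J ->
  (forall m, P m -> J 'X_[m]) -> mon_ideal P `<=` J.
Proof.
move=> idJ PJ f hf; rewrite (mpolyE f) big_seq; apply: ideal_sum => // m /hf Pm.
by case: idJ => _ _ JM; rewrite -mul_mpolyC; apply: JM; exact: PJ.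
Qed.

Lemma mon_ideal_eq P Q : (forall m, P m <-> Q m) -> mon_ideal P = mon_ideal Q.
Proof. by move=> PQ; congr mon_ideal; apply/funext => m; apply/propext. Qed.

Lemma ideal_gen_monomials (M : set 'X_{1..N}) :
  ideal_gen [set 'X_[K, m] | m in M] =
  mon_ideal (fun m => exists2 m0, M m0 & (m0 <= m)%MM).
Proof.
have uP : up_closed (fun m => exists2 m0, M m0 & (m0 <= m)%MM).
  by move=> m m' [m0 Mm0 le]; exists m0 => //; apply: lepm_trans le (lem_addr _ _).
apply/seteqP; split.
  apply: ideal_gen_min; first exact: mon_ideal_ideal.
  by move=> _ [m Mm <-]; apply/mon_idealX; exists m; rewrite ?lepm_refl.
apply: mon_ideal_min; first exact: ideal_gen_ideal.
move=> m [m0 Mm0 /submK <-]; rewrite mpolyXD.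
have [_ _] := ideal_gen_ideal [set 'X_[K, m] | m in M]; apply.
by apply: sub_ideal_gen; exists m0.
Qed.

Lemma ideal_mul_mon P Q : up_closed P -> up_closed Q ->
  ideal_mul (mon_ideal P) (mon_ideal Q) =
  mon_ideal (fun m => exists m1 m2, [/\ P m1, Q m2 & m = (m1 + m2)%MM]).
Proof.
move=> uP uQ; apply/seteqP; split.
  apply: ideal_gen_min.
    apply: mon_ideal_ideal => _ m' [m1 [m2 [P1 Q2 ->]]].
    by exists m1, (m2 + m')%MM; split => //; [exact: uQ | rewrite addmA].
  move=> _ [f Pf [g Qg <-]] m /msuppM_le /allpairsP[[m1 m2] /= [/Pf P1 /Qg Q2 ->]].
  by exists m1, m2.
apply: mon_ideal_min; first exact: ideal_gen_ideal.
move=> _ [m1 [m2 [P1 Q2 ->]]]; apply: sub_ideal_gen; rewrite mpolyXD.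
by exists 'X_[m1]; [exact/mon_idealX | exists 'X_[m2] => //; exact/mon_idealX].
Qed.

Lemma ideal_add_mon P Q : up_closed P -> up_closed Q ->
  ideal_add (mon_ideal P) (mon_ideal Q) = mon_ideal (fun m => P m \/ Q m).
Proof.
move=> uP uQ; apply/seteqP; split.
  move=> _ [f Pf [g Qg <-]] m /msuppD_le; rewrite mem_cat => /orP[/Pf|/Qg]; tauto.
have [P0 _ _] := mon_ideal_ideal uP; have [Q0 _ _] := mon_ideal_ideal uQ.
apply: mon_ideal_min; first by apply: ideal_add_ideal; exact: mon_ideal_ideal.
move=> m [Pm|Qm].
  by exists 'X_[m]; [exact/mon_idealX | exists 0 => //; rewrite addr0].
by exists 0 => //; exists 'X_[m]; [exact/mon_idealX | rewrite add0r].
Qed.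

Lemma big_ideal_add_mon (T : eqType) (r : seq T) (P : T -> 'X_{1..N} -> Prop) :
  (forall t, up_closed (P t)) ->
  \big[@ideal_add _/ideal0]_(t <- r) mon_ideal (P t) =
  mon_ideal (fun m => exists2 t, t \in r & P t m).
Proof.
move=> uP; elim: r => [|t r IH].
  rewrite big_nil; apply/seteqP; split => [f ->|f hf].
    by move=> m; rewrite msupp0.
  apply/msuppnil0; case E: (msupp f) => [//|m l].
  by have [|t] := hf m; rewrite ?E ?mem_head.
rewrite big_cons IH ideal_add_mon //; last first.
  by move=> m m' [x xr Px]; exists x => //; exact: uP.
apply: mon_ideal_eq => m; split.
  by move=> [Pm|[x xr Px]]; [exists t | exists x] => //; rewrite inE ?eqxx ?xr ?orbT.
by move=> [x]; rewrite inE => /orP[/eqP ->|xr] Px; [left | right; exists x].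
Qed.

Definition msupp_filter (a : pred 'X_{1..N}) f : {mpoly K[N]} :=
  \sum_(m <- msupp f | a m) f@_m *: 'X_[m].

Lemma mcoeff_filter a f m : (msupp_filter a f)@_m = if a m then f@_m else 0.
Proof.
rewrite /msupp_filter raddf_sum /=.
under eq_bigr do rewrite mcoeffZ mcoeffX.
case: (boolP (m \in msupp f)) => mf; last first.
  rewrite big_seq_cond big1 ?(memN_msupp_eq0 mf) ?if_same // => m' /andP[m'f _].
  by case: eqP => [E|_]; rewrite ?mulr0 //; rewrite E (negPf mf) in m'f.
rewrite big_mkcond (bigD1_seq m) ?msupp_uniq //= eqxx mulr1 big1 ?addr0 //.
by move=> m' /negPf ->; rewrite mulr0 if_same.
Qed.

(* Compare the parts of lowest [wd]-degree: the product of the part of [u] of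
   degree zero and of the lowest part of [f] outside [P] cannot be cancelled. *)
Lemma mon_ideal_primary P (wd : 'X_{1..N} -> nat) :
  {morph wd : m1 m2 / (m1 + m2)%MM >-> (m1 + m2)%N} ->
  up_closed P -> (forall m a, wd a = 0%N -> P (m + a)%MM -> P m) ->
  forall u f, ~ mon_ideal (fun m => (0 < wd m)%N) u ->
    mon_ideal P (u * f) -> mon_ideal P f.
Proof.
move=> wdD uP offP u f hu huf; apply: contrapT => hf.
pose bad m := ~~ `[< P m >].
have hd : exists d, has (fun m => bad m && (wd m == d)) (msupp f).
  move/existsNP : hf => [m /not_implyP[mf nP]].
  by exists (wd m); apply/hasP; exists m => //; rewrite eqxx andbT; apply/asboolPn.
case: (ex_minnP hd) => d /hasP[m0 m0f bad0] dmin.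
pose f1 := msupp_filter (fun m => bad m && (wd m == d)) f.
pose u1 := msupp_filter (fun m => wd m == 0%N) u.
have f1_supp m : m \in msupp f1 -> bad m /\ wd m = d.
  by rewrite mcoeff_msupp mcoeff_filter; case: ifP => [/andP[? /eqP]|_]; rewrite ?eqxx.
have u1_supp m : m \in msupp u1 -> wd m = 0%N.
  by rewrite mcoeff_msupp mcoeff_filter; case: ifP => [/eqP|_] //; rewrite eqxx.
have ff1_supp m : m \in msupp (f - f1) -> bad m -> (d < wd m)%N.
  rewrite mcoeff_msupp mcoeffB mcoeff_filter => + bm; rewrite bm /=.
  case: (wd m =P d) => [_|/eqP nd]; first by rewrite subrr eqxx.
  rewrite subr0 -mcoeff_msupp => mf; rewrite ltn_neqAle eq_sym nd /=.
  by apply: dmin; apply/hasP; exists m; rewrite ?bm /=.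
have uu1_supp m : m \in msupp (u - u1) -> (0 < wd m)%N.
  rewrite mcoeff_msupp mcoeffB mcoeff_filter lt0n.
  by case: (wd m =P 0%N) => //; rewrite subrr eqxx.
have f1_neq0 : f1 != 0.
  apply: contraTneq m0f => E; rewrite mcoeff_msupp negbK.
  by move/(congr1 (mcoeff m0))/eqP: E; rewrite mcoeff_filter bad0 mcoeff0.
have u1_neq0 : u1 != 0.
  apply: contra_notN hu => /eqP u10 m; rewrite -[u](subrK u1) u10 addr0 -{1}u10.
  exact: uu1_supp.
have [m mS] : exists m, m \in msupp (u1 * f1).
  have : u1 * f1 != 0 by rewrite mulf_neq0.
  by rewrite -msupp_eq0; case: (msupp _) => // m l _; exists m; rewrite mem_head.
have [badm wdm] : bad m /\ wd m = d.
  have /allpairsP[[a1 a2] /= [/u1_supp w1 /f1_supp [b2 w2] ->]] := msuppM_le mS.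
  split; last by rewrite wdD w1 w2.
  by apply: contraNN b2 => /asboolP; rewrite addmC => /(offP _ _ w1) ?; apply/asboolP.
(* Only [u1 * f1] contributes at [m]: the monomials of [(u - u1) * f1] have degree above [d], and
   those of [u * (f - f1)] have degree above [d] or satisfy [P]. *)
have E : u * f = u1 * f1 + ((u - u1) * f1 + u * (f - f1)).
  by rewrite !mulrBr !mulrBl addrA [u1 * f1 + _]addrC subrK addrC subrK.
have z1 : ((u - u1) * f1)@_m = 0.
  apply: memN_msupp_eq0; apply/negP => /msuppM_le /allpairsP[[a1 a2] /=].
  by move=> [/uu1_supp w1 /f1_supp [_ w2] Em]; move: wdm; rewrite Em wdD; lia.
have z2 : (u * (f - f1))@_m = 0.
  apply: memN_msupp_eq0; apply/negP => /msuppM_le /allpairsP[[a1 a2] /=].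
  move=> [_ /ff1_supp w2 Em]; case: (boolP (bad a2)) => [/w2 {}w2|].
    by move: wdm; rewrite Em wdD; lia.
  by rewrite negbK => /asboolP /(uP _ a1); rewrite addmC -Em => /asboolP; exact/negP.
suff /huf /asboolP : m \in msupp (u * f) by exact/negP.
by rewrite mcoeff_msupp E !mcoeffD z1 z2 !addr0 -mcoeff_msupp.
Qed.

End MonomialIdeals.

Arguments mon_ideal {N} K P.

(** * Products of powers of the edge ideal and of the cycle monomial as packings *)

Section Packings.
Variables (K : fieldType) (V : finType) (D : wograph V) (C : seq V).
Implicit Types (m : 'X_{1..#|V|}) (v x y : V) (W : {set V}).

Definition exponent m v : nat := m (enum_rank v).

Definition monomial_of (g : V -> nat) : 'X_{1..#|V|} :=
  [multinom g (enum_val i) | i < #|V|].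

Lemma exponent_monomial g v : exponent (monomial_of g) v = g v.
Proof. by rewrite /exponent mnmE enum_rankK. Qed.

Lemma exponentD m1 m2 v : exponent (m1 + m2)%MM v = (exponent m1 v + exponent m2 v)%N.
Proof. exact: mnmDE. Qed.

Lemma exponent_eq m1 m2 : (forall v, exponent m1 v = exponent m2 v) -> m1 = m2.
Proof. by move=> h; apply/mnmP => i; rewrite -(enum_valK i); apply: h. Qed.

Lemma exponent_leP m1 m2 :
  (m1 <= m2)%MM <-> forall v, (exponent m1 v <= exponent m2 v)%N.
Proof.
split; first by move=> /mnm_lepP h v; exact: h.
by move=> h; apply/mnm_lepP => i; rewrite -(enum_valK i); exact: h.
Qed.

Lemma mdeg_exponent m : mdeg m = (\sum_v exponent m v)%N.
Proof.
rewrite mdegE (reindex (@enum_rank V)) //.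
by exists enum_val => i _; rewrite ?enum_rankK ?enum_valK.
Qed.

Lemma prod_Xv (r : seq V) (P : pred V) (g : V -> nat) :
  \prod_(x <- r | P x) Xv K x ^+ g x =
  'X_[monomial_of (fun v => \sum_(x <- r | P x) (x == v) * g x)%N].
Proof.
elim: r => [|x r IH].
  rewrite big_nil -mpolyX0; congr 'X_[_]; apply: exponent_eq => v.
  by rewrite exponent_monomial big_nil /exponent mnm0E.
rewrite big_cons IH; case: ifP => Px; last first.
  congr 'X_[_]; apply: exponent_eq => v; rewrite !exponent_monomial.
  by rewrite big_cons Px.
rewrite /Xv mpolyXn -mpolyXD; congr 'X_[_]; apply: exponent_eq => v.
rewrite exponentD !exponent_monomial big_cons Px /exponent mulmnE mnm1E.
by rewrite (inj_eq enum_rank_inj).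
Qed.

(* [x_v ^ w(v)] plays the role of the variable [v] of the unweighted graph. *)
Definition quotient_exp m v : nat := exponent m v %/ weight D v.

Lemma leq_quotient_exp k m v :
  (k <= quotient_exp m v)%N = (k * weight D v <= exponent m v)%N.
Proof. by rewrite /quotient_exp leq_divRL ?weight_gt0. Qed.

Lemma quotient_expD m1 m2 v :
  (quotient_exp m1 v + quotient_exp m2 v <= quotient_exp (m1 + m2)%MM v)%N.
Proof.
by rewrite leq_quotient_exp exponentD mulnDl leq_add // -leq_quotient_exp.
Qed.

Lemma quotient_exp_le m1 m2 v : (m1 <= m2)%MM ->
  (quotient_exp m1 v <= quotient_exp m2 v)%N.
Proof. by move=> /exponent_leP h; apply: leq_div2r; exact: h. Qed.

(** When the vertices of [Vplus D] are sinks and [C] has no repetition, these are the exponents of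
    the monomials in [I^s (c)^t]; see [mixed_ideal_packs]. *)
Definition packs s t m : Prop := exists E, [/\ edge_list D E, size E = s &
  forall v, (mult E v + t * (v \in C) <= quotient_exp m v)%N].

Lemma packs_up s t : up_closed (packs s t).
Proof.
move=> m m' [E [hE sE mE]]; exists E; split => // v.
by apply: (leq_trans (mE v)); apply: quotient_exp_le; exact: lem_addr.
Qed.

(** The edge list is cut after [s1] entries: [m1] is exactly what these and [t1] cycles use up, and
    [m - m1] has room for the rest. Conversely, packings are concatenated, since quotient exponents
    are superadditive. *)
Lemma packsD s1 t1 s2 t2 m : packs (s1 + s2) (t1 + t2) m <->
  exists m1 m2, [/\ packs s1 t1 m1, packs s2 t2 m2 & m = (m1 + m2)%MM].
Proof.
split; last first.
  move=> [a1 [a2 [[E1 [h1 <- l1]] [E2 [h2 <- l2]] ->]]].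
  exists (E1 ++ E2); split; rewrite ?size_cat //.
    by rewrite /edge_list all_cat; apply/andP.
  move=> v; apply: leq_trans (quotient_expD _ _ _).
  by rewrite mult_cat mulnDl addnACA leq_add.
move=> [E [hE sE mE]].
move: hE; rewrite -(cat_take_drop s1 E) /edge_list all_cat => /andP[h1 h2].
pose m1 := monomial_of (fun v => (mult (take s1 E) v + t1 * (v \in C)) * weight D v)%N.
have le1 : (m1 <= m)%MM.
  apply/exponent_leP => v; rewrite exponent_monomial -leq_quotient_exp.
  apply: leq_trans (mE v); rewrite mulnDl addnA.
  by apply: leq_trans (leq_addr _ _); rewrite leq_add2r mult_take.
exists m1, (m - m1)%MM; split; last by rewrite addmC submK.
  exists (take s1 E); split=> //; first by rewrite size_takel // sE leq_addr.
  by move=> v; rewrite leq_quotient_exp exponent_monomial.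
exists (drop s1 E); split=> //; first by rewrite size_drop sE addKn.
move=> v; rewrite leq_quotient_exp /exponent mnmBE -!/(exponent _ v).
rewrite exponent_monomial leq_subRL; last first.
  by rewrite -(exponent_monomial (fun v => (mult (take s1 E) v + t1 * (v \in C)) * weight D v)%N);
    move/exponent_leP: le1; apply.
rewrite -mulnDl -leq_quotient_exp; apply: leq_trans (mE v).
by rewrite addnACA -mult_cat cat_take_drop -mulnDl.
Qed.

Lemma packs00 m : packs 0 0 m.
Proof. by exists [::]; split => // v; rewrite mult_nil. Qed.

Lemma setT_packs : [set: {mpoly K[#|V|]}] = mon_ideal K (packs 0 0).
Proof. by apply/seteqP; split => // f _ m _; exact: packs00. Qed.

Lemma ideal_mul_packs s1 t1 s2 t2 :
  ideal_mul (mon_ideal K (packs s1 t1)) (mon_ideal K (packs s2 t2)) =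
  mon_ideal K (packs (s1 + s2) (t1 + t2)).
Proof.
rewrite ideal_mul_mon; [|exact: packs_up..].
by apply: mon_ideal_eq => m; rewrite packsD.
Qed.

Lemma ideal_pow_packs s t k :
  ideal_pow (mon_ideal K (packs s t)) k = mon_ideal K (packs (k * s) (k * t)).
Proof.
elim: k => [|k IH]; first exact: setT_packs.
by rewrite /ideal_pow iterS -/(ideal_pow _ _) IH ideal_mul_packs !mulSn.
Qed.

Hypothesis hsink : forall x : V, x \in Vplus D -> is_sink D x.

Lemma weight_tail x y : Defs.arc D x y -> weight D x = 1%N.
Proof.
move=> xy; apply/eqP; apply/negP => /negP wx.
have /hsink/(_ y) : x \in Vplus D by rewrite /Vplus finset.inE.
by rewrite xy.
Qed.

Lemma edge_ideal_packs : edge_ideal K D = mon_ideal K (packs 1 0).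
Proof.
pose em x y := monomial_of (fun v => (x == v) + (y == v) * weight D y)%N.
have emE x y : Xv K x * Xv K y ^+ weight D y = 'X_[em x y].
  rewrite /Xv mpolyXn -mpolyXD; congr 'X_[_]; apply: exponent_eq => v.
  by rewrite exponentD exponent_monomial /exponent mulmnE !mnm1E !(inj_eq enum_rank_inj).
pose M := [set m | exists x y, Defs.arc D x y /\ m = em x y].
have -> : edge_ideal K D = ideal_gen [set 'X_[K, m] | m in M].
  congr ideal_gen; apply/seteqP; split => [_ [x [y [xy ->]]]|_ [_ [x [y [xy ->]]] <-]].
    by exists (em x y); [exists x, y | rewrite emE].
  by exists x, y; rewrite emE.
rewrite ideal_gen_monomials; apply: mon_ideal_eq => m.
have emw x y v : Defs.arc D x y ->
    exponent (em x y) v = (((x == v) + (y == v)) * weight D v)%N.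
  move=> xy; rewrite exponent_monomial mulnDl; congr addn.
    by case: eqP => // <-; rewrite (weight_tail xy).
  by case: eqP => [<-|].
split.
  move=> [_ [x [y [xy ->]]] /exponent_leP le].
  exists [:: (x, y)]; split => //=; first by rewrite /edge_list /= /adj xy.
  move=> v; rewrite mult_cons mult_nil mul0n !addn0 leq_quotient_exp -emw //.
move=> [[|[x y] [|? ?]] [xy // _ mE]]; rewrite /edge_list /= andbT in xy.
wlog xy' : x y xy mE / Defs.arc D x y.
  move=> Hw; case/orP: (xy) => [|yx]; first exact: Hw.
  apply: (Hw y x) => //; first by rewrite adjC.
  by move=> v; move: (mE v); rewrite !mult_cons /= [((y == v) + _)%N]addnC.
exists (em x y); first by exists x, y.
apply/exponent_leP => v; rewrite emw // -leq_quotient_exp.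
by move: (mE v); rewrite mult_cons mult_nil mul0n !addn0.
Qed.

Lemma ideal_pow_edge s :
  ideal_pow (edge_ideal K D) s = mon_ideal K (packs s 0).
Proof. by rewrite edge_ideal_packs ideal_pow_packs muln1 muln0. Qed.

Hypothesis C_uniq : uniq C.

Lemma cycle_ideal_packs :
  ideal_gen [set cycle_monomial K D C] = mon_ideal K (packs 0 1).
Proof.
pose cm := monomial_of (fun v => (v \in C) * weight D v)%N.
have -> : cycle_monomial K D C = 'X_[cm].
  rewrite /cycle_monomial.
  under eq_bigr => x _ do rewrite -[Xv K x]expr1.
  rewrite !prod_Xv -mpolyXD; congr 'X_[_]; apply: exponent_eq => v.
  rewrite exponentD !exponent_monomial.
  (* Outside [Vplus D] the weight is one, so both factors of the cycle monomial merge into the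
     product of all [x^w(x)] over [C]. *)
  have -> : (\sum_(x <- C | x \notin Vplus D) (x == v) * 1 =
             \sum_(x <- C | x \notin Vplus D) (x == v) * weight D x)%N.
    apply: eq_bigr => x; rewrite /Vplus finset.inE negbK => /eqP ->//.
  transitivity (\sum_(x <- C) (x == v) * weight D x)%N.
    by rewrite addnC [RHS](bigID (mem (Vplus D))).
  case: (boolP (v \in C)) => vC; last first.
    rewrite big_seq big1 // => x xC; case: eqP => // E.
    by rewrite -E xC in vC.
  rewrite (bigD1_seq v) //= eqxx big1 ?addn0 // => x /negPf.
  by move=> ->.
rewrite -[[set 'X_[cm]]]image_set1 ideal_gen_monomials; apply: mon_ideal_eq => m.
split.
  move=> [_ -> /exponent_leP le]; exists [::]; split=> // v.
  rewrite mult_nil mul1n add0n leq_quotient_exp.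
  by rewrite -(exponent_monomial (fun v => (v \in C) * weight D v)%N).
move=> [E [_ /size0nil -> mE]]; exists cm => //; apply/exponent_leP => v.
by rewrite exponent_monomial -leq_quotient_exp; move: (mE v); rewrite mult_nil mul1n.
Qed.

Lemma mixed_ideal_packs s t :
  ideal_mul (ideal_pow (edge_ideal K D) s)
            (ideal_pow (ideal_gen [set cycle_monomial K D C]) t) =
  mon_ideal K (packs s t).
Proof.
by rewrite ideal_pow_edge cycle_ideal_packs ideal_pow_packs ideal_mul_packs
  muln0 muln1 addn0.
Qed.

End Packings.

(** * Associated primes of the edge ideal and its symbolic powers *)

Section SymbolicPowers.
Variables (K : fieldType) (V : finType) (D : wograph V) (C : seq V).
Hypothesis hsink : forall x : V, x \in Vplus D -> is_sink D x.
Implicit Types (m : 'X_{1..#|V|}) (v x y : V) (W : {set V}).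

Local Notation I := (edge_ideal K D).
Local Notation q := (quotient_exp D).

Definition covers_weigh s m : Prop :=
  forall W, vertex_cover D W -> (s <= \sum_(v in W) q m v)%N.

(** Inclusion-minimality in witness form: a vertex all of whose neighbours lie in [W] could be
    removed from [W]. *)
Definition minimal_cover W : Prop := vertex_cover D W /\
  forall v, v \in W -> exists2 u, u \notin W & adj D v u.

Lemma exists_minimal_cover W : vertex_cover D W ->
  exists2 W', minimal_cover W' & W' \subset W.
Proof.
move=> cW; have PW : `[< vertex_cover D W >] by apply/asboolP.
have [W' /minsetP[/asboolP cW' minW'] sub] :=
  minset_exists (P := fun W => `[< vertex_cover D W >]) PW.
exists W' => //; split=> // v vW'; apply: contrapT => h.
have nb u : adj D v u -> u \in W'.
  by move=> vu; apply: contraPT (fun _ => h) => uW' /(_ isT); apply; exists u.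
have : (W' :\ v)%SET = W'.
  apply: minW'; last exact: subD1set.
  apply/asboolP => x y xy; rewrite !finset.inE.
  case: (eqVneq x v) => [E|nx] /=.
    by rewrite -E eq_sym (adj_neq xy) nb // -E.
  case: (eqVneq y v) => [E|ny] /=.
    by rewrite nb // -E adjC.
  exact: cW'.
by move/finset.setP/(_ v); rewrite vW' finset.setD11.
Qed.

(** The prime generated by the variables of [W], since a monomial has positive degree in [W] iff one
    of these variables divides it. *)
Definition var_ideal W : set {mpoly K[#|V|]} :=
  mon_ideal K (fun m => 0 < \sum_(v in W) exponent m v)%N.

Lemma wdegD W : {morph (fun m => \sum_(v in W) exponent m v)%N :
  m1 m2 / (m1 + m2)%MM >-> (m1 + m2)%N}.
Proof. by move=> m1 m2; rewrite -big_split; apply: eq_bigr => v _; exact: exponentD. Qed.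

Lemma wdeg0 W m v : (\sum_(v in W) exponent m v = 0)%N -> v \in W -> exponent m v = 0%N.
Proof. by move=> /eqP; rewrite sum_nat_eq0 => /forall_inP h /h /eqP. Qed.

Lemma var_ideal_prime W : is_prime_ideal (var_ideal W).
Proof.
have up : up_closed (fun m => 0 < \sum_(v in W) exponent m v)%N.
  by move=> m m'; rewrite wdegD; lia.
split; first exact: mon_ideal_ideal.
  move=> /(_ 0%MM); rewrite msupp1 mem_head => /(_ isT).
  by rewrite big1 // => v _; rewrite /exponent mnm0E.
move=> a b ab; case: (pselect (var_ideal W a)) => ha; first by left.
right; apply: (mon_ideal_primary (wdegD W) up _ ha ab) => m m' w0.
by rewrite wdegD w0 addn0.
Qed.

(** Variables off [W] do not affect the quotient exponents on [W], which is what [mon_ideal_primary]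
    asks for. *)
Lemma cover_component_primary W s u f : ~ var_ideal W u ->
  mon_ideal K (fun m => s <= \sum_(v in W) q m v)%N (u * f) ->
  mon_ideal K (fun m => s <= \sum_(v in W) q m v)%N f.
Proof.
apply: (mon_ideal_primary (wdegD W)) => [m m'|m a wa].
  by move/leq_trans; apply; apply: leq_sum => v _; apply: quotient_exp_le; exact: lem_addr.
under eq_bigr => v vW do rewrite /quotient_exp exponentD (wdeg0 wa vW) addn0.
by [].
Qed.

Lemma packs_cover W s m : vertex_cover D W -> packs D C s 0 m ->
  (s <= \sum_(v in W) q m v)%N.
Proof.
move=> cW [E [hE <- mE]]; apply: (leq_trans (cover_mult cW hE)).
by apply: leq_sum => v _; apply: leq_trans (mE v); exact: leq_addr.
Qed.

Lemma packs10 m : packs D C 1 0 m <->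
  exists x y, [/\ adj D x y, (0 < q m x)%N & (0 < q m y)%N].
Proof.
split.
  move=> [[|[x y] [|? ?]] [xy // _ mE]]; exists x, y.
  rewrite /edge_list /= andbT in xy; split=> //.
    by apply: leq_trans (mE x); rewrite mult_cons eqxx.
  by apply: leq_trans (mE y); rewrite mult_cons /= eqxx -!addnA addnCA.
move=> [x [y [xy qx qy]]]; exists [:: (x, y)]; split=> //; first by rewrite /edge_list /= xy.
move=> v; rewrite mult_cons mult_nil mul0n !addn0 /=.
case: (eqVneq x v) => [<-|_]; first by rewrite eq_sym (negPf (adj_neq xy)).
by case: (eqVneq y v) => [<-|_].
Qed.

Lemma not_packs10 m : ~ packs D C 1 0 m ->
  exists2 W, vertex_cover D W & (\sum_(v in W) q m v = 0)%N.
Proof.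
move=> h; exists [set v | q m v == 0%N]%SET.
  move=> x y xy; rewrite !finset.inE.
  case: (posnP (q m x)) => // qx; case: (posnP (q m y)) => // qy.
  by case: h; apply/packs10; exists x, y.
by rewrite big1 // => v; rewrite finset.inE => /eqP.
Qed.

Lemma minimal_cover_Ass W : minimal_cover W -> Ass I (var_ideal W).
Proof.
move=> [cW minW]; split; first exact: var_ideal_prime.
(* On [W] the exponent is one short of a full weight and off [W] it is a full weight. A further
   variable [v] of [W] thus completes an edge to a neighbour off [W], while any completed edge needs
   such a variable; so [(I : X^G)] is [var_ideal W]. *)
pose G := monomial_of (fun v => if v \in W then (weight D v).-1 else weight D v).
have qG m v : (0 < q (m + G)%MM v)%N = (v \notin W) || (0 < exponent m v)%N.
  rewrite leq_quotient_exp exponentD exponent_monomial; have := weight_gt0 D v.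
  case: (v \in W) => /=; lia.
have key m : (0 < \sum_(v in W) exponent m v)%N <-> packs D C 1 0 (m + G)%MM.
  split=> [|/packs10 [x [y [xy]]]].
    rewrite lt0n sum_nat_eq0 negb_forall_in => /exists_inP[v vW mv].
    have [u uW vu] := minW _ vW; apply/packs10; exists v, u.
    by rewrite !qG vW uW lt0n mv.
  rewrite !qG => hx hy; rewrite lt0n sum_nat_eq0 negb_forall_in.
  case/orP: (cW _ _ xy) => [xW|yW].
    by apply/exists_inP; exists x; rewrite // -lt0n; move: hx; rewrite xW.
  by apply/exists_inP; exists y; rewrite // -lt0n; move: hy; rewrite yW.
exists 'X_[G]; rewrite (edge_ideal_packs K C hsink); apply/seteqP; split=> h hh m.
  rewrite (perm_mem (msuppMX _ _)) => /mapP[m' m'h ->].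
  by rewrite addmC; apply/key; exact: hh.
move=> mh; apply/key; apply: hh.
by rewrite (perm_mem (msuppMX _ _)); apply/mapP; exists m; rewrite // addmC.
Qed.

(** If [p = (I : g)], some monomial [m] of [g] lies outside [I], and [W] is chosen among the zeros
    of [q m]. Were some [h] in [p] outside [var_ideal W], cancelling it from [h * g] would give [m]
    positive weight on [W]. The containment already makes every element outside [var_ideal W] a
    denominator at [p]. *)
Lemma Ass_sub_var_ideal p : Ass I p ->
  exists2 W, minimal_cover W & p `<=` var_ideal W.
Proof.
rewrite (edge_ideal_packs K C hsink) => -[[_ p1 _] [g Ep]].
have [m [mg nm]] : exists m, m \in msupp g /\ ~ packs D C 1 0 m.
  apply: contra_notP p1 => h; rewrite Ep /= mul1r => m mg.
  by apply: contrapT => nm; apply: h; exists m.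
have [W0 cW0 W00] := not_packs10 nm.
have [W minW sW] := exists_minimal_cover cW0.
exists W => // h; rewrite Ep /= => hg; apply: contrapT => hW.
have /(_ m mg) : mon_ideal K (fun m => 1 <= \sum_(v in W) q m v)%N g.
  apply: (cover_component_primary hW) => m' /hg; apply: packs_cover.
  by case: minW.
suff -> : (\sum_(v in W) q m v = 0)%N by [].
apply/eqP; rewrite sum_nat_eq0; apply/forall_inP => v vW.
by move/eqP: W00; rewrite sum_nat_eq0 => /forall_inP; apply; apply: (fintype.subsetP sW).
Qed.

(** Each unit of weight at a vertex of [W] is spent on an edge to a neighbour off [W], which costs
    nothing elsewhere in [W]. *)
Lemma edges_at_cover W (b : V -> nat) s : minimal_cover W ->
  (s <= \sum_(v in W) b v)%N ->
  exists E, [/\ edge_list D E, size E = s & forall v, v \in W -> (mult E v <= b v)%N].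
Proof.
move=> [_ minW]; elim: s b => [|s IH] b hb.
  by exists [::]; split=> // v _; rewrite mult_nil.
have [v vW bv] : exists2 v, v \in W & (0 < b v)%N.
  have : (\sum_(v in W) b v != 0)%N by rewrite -lt0n; apply: leq_trans hb.
  rewrite sum_nat_eq0 negb_forall_in => /exists_inP[v vW bv].
  by exists v; rewrite // lt0n.
have [u uW vu] := minW _ vW.
have bE y : b y = (b y - (v == y) + (v == y))%N by rewrite subnK //; case: eqP => // <-.
have [|E [hE sE mE]] := IH (fun y => b y - (v == y))%N.
  move: hb; under eq_bigr => y _ do rewrite bE.
  by rewrite big_split /= sum_pred1 vW addn1.
exists ((v, u) :: E); split => [||y yW]; rewrite /edge_list /= ?vu ?sE //.
rewrite mult_cons /= (bE y) [(u == y)](_ : _ = false) ?addn0; last first.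
  by apply: contraNF uW => /eqP ->.
by rewrite addnC leq_add2r mE.
Qed.

Lemma mult_le_size E v : edge_list D E -> (mult E v <= size E)%N.
Proof.
elim: E => [|[x y] E IH] /=; first by rewrite mult_nil.
move=> /andP[/= xy /IH]; rewrite mult_cons /= -add1n; apply: leq_add.
case: (eqVneq x v) => [<-|_]; first by rewrite eq_sym (negPf (adj_neq xy)).
by case: (y == v).
Qed.

(* Modulo units of [R_p], every edge at a minimal cover [W] contributes a pure
   power of a variable of [W]. *)
Theorem symbolic_power_edge s :
  symbolic_power I s = mon_ideal K (covers_weigh s).
Proof.
have idI : is_ideal (mon_ideal K (packs D C s 0)) by apply/mon_ideal_ideal/packs_up.
rewrite /symbolic_power (ideal_pow_edge K C hsink); apply/seteqP; split => f hf.
  move=> m mf W cW; have [W' minW' sW] := exists_minimal_cover cW.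
  have /(loc_contractP _ (var_ideal_prime W') idI)[u uW uf] := hf _ (minimal_cover_Ass minW').
  have /(_ m mf) : mon_ideal K (fun m => s <= \sum_(v in W') q m v)%N f.
    apply: (cover_component_primary uW) => m' /uf; apply: packs_cover.
    by case: minW'.
  move/leq_trans; apply; rewrite [X in (_ <= X)%N](big_setID W') /=.
  by rewrite (finset.setIidPr sW) leq_addr.
move=> p hp; have [W minW pW] := Ass_sub_var_ideal hp; have [pp _] := hp.
apply/(loc_contractP _ pp idI).
(* The multiplier involves only variables off [W], hence lies outside [p], and its exponents leave
   room for the outer ends of any [s] edges. *)
pose g v := if v \in W then 0%N else (s * weight D v)%N.
exists (\prod_(v <- enum V | v \notin W) Xv K v ^+ g v).
  rewrite -big_filter; set r := [seq v <- _ | _].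
  have rW v : v \in r -> v \notin W by rewrite mem_filter => /andP[].
  elim: r rW => [|v r IH] rW; first by rewrite big_nil; case: pp.
  rewrite big_cons => h; have [_ _ pM] := pp.
  case: (pM _ _ h) => [|]; last by apply: IH => w wr; apply: rW; rewrite inE wr orbT.
  apply: prime_exp => // /pW /(_ U_(enum_rank v)%MM).
  rewrite /Xv msuppX mem_head => /(_ isT); rewrite big1 // => w wW.
  rewrite /exponent mnm1E (inj_eq enum_rank_inj); case: eqP => // E.
  by move: (rW v); rewrite mem_head E wW => /(_ isT).
rewrite prod_Xv => m; rewrite mulrC (perm_mem (msuppMX _ _)) => /mapP[m' m'f ->].
have [E [hE sE mE]] := edges_at_cover minW (hf m' m'f W (proj1 minW)).
exists E; split=> // v; rewrite mul0n addn0.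
case: (boolP (v \in W)) => vW.
  by apply: leq_trans (mE v vW) _; apply: quotient_exp_le; exact: lem_addl.
apply: leq_trans (mult_le_size v hE) _; rewrite sE leq_quotient_exp exponentD.
rewrite exponent_monomial; apply: leq_trans (leq_addr _ _).
rewrite big_mkcond (bigD1_seq v) ?mem_enum ?enum_uniq //= vW eqxx mul1n /g (negPf vW).
exact: leq_addr.
Qed.

End SymbolicPowers.

(** * Initial degrees and the limit defining the Waldschmidt constant *)

Section Alpha.
Variables (N : nat) (K : fieldType).

Lemma alpha_mon_ideal (P : 'X_{1..N} -> Prop) d :
  (exists2 m, P m & mdeg m = d) -> (forall m, P m -> (d <= mdeg m)%N) ->
  alpha (mon_ideal K P) = d.
Proof.
move=> [m0 Pm0 dm0] minP.
have lb e : has_degree (mon_ideal K P) e -> (d <= e)%N.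
  move=> [f [Pf f0 /dhomogP hf]]; rewrite -msupp_eq0 in f0.
  case E: (msupp f) f0 => [//|m l] _.
  have mf : m \in msupp f by rewrite E mem_head.
  by rewrite -(hf m mf); apply: minP; exact: Pf.
have dP : has_degree (mon_ideal K P) d.
  exists 'X_[m0]; split; first exact/mon_idealX.
    by rewrite -msupp_eq0 msuppX.
  by rewrite dhomogX; apply/eqP.
apply: xget_unique => [//|e [he le]]; apply/eqP.
by rewrite eqn_leq le // lb.
Qed.

Lemma waldschmidt_of_bounds (R : realType) (I : set {mpoly K[N]}) (c : R) :
  (forall s, (0 < s)%N -> c * s%:R <= (alpha (symbolic_power I s))%:R <= c * s%:R + 1) ->
  cvg (waldschmidt_seq R I @ \oo) /\ waldschmidt R I = c.
Proof.
move=> h.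
suff cv : waldschmidt_seq R I @ \oo --> c.
  by split; [apply/cvg_ex; exists c | exact/cvg_lim].
(* [harmonic s] is [1 / (s + 1)], and the factor [2] makes it dominate [1 / s] for positive [s]. *)
apply: (@squeeze_cvgr _ _ _ _ (fun=> c) (fun s => c + 2 * harmonic s)).
- near=> s; have s0 : (0 < s)%N by near: s; exact: nbhs_infty_gt.
  have sR : 0 < s%:R :> R by rewrite ltr0n.
  have /andP[h1 h2] := h _ s0.
  rewrite /waldschmidt_seq ler_pdivlMr // h1 /= ler_pdivrMr //.
  apply: (le_trans h2); rewrite mulrDl lerD2l /harmonic /=.
  rewrite mulrAC ler_pdivlMr ?ltr0n // mul1r -natrM ler_nat; lia.
- exact: cvg_cst.
- rewrite -[X in _ --> X]addr0 -[X in _ + X](mulr0 2).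
  by apply: cvgD; [exact: cvg_cst | apply: cvgM; [exact: cvg_cst | exact: cvg_harmonic]].
Unshelve. all: by end_near.
Qed.

End Alpha.

(** * Symbolic powers and initial degrees for the odd unicyclic graph *)

Section OddUnicyclicEdgeIdeal.
Variables (K : fieldType) (V : finType) (D : wograph V) (n : nat) (C : seq V).
Hypothesis hsink : forall x : V, x \in Vplus D -> is_sink D x.
Hypothesis hsize : size C = (2 * n + 1)%N.
Hypothesis hC : unicyclic_with_cycle D C.
Implicit Types (m : 'X_{1..#|V|}) (v x y : V).

Local Notation I := (edge_ideal K D).
Local Notation c := (cycle_monomial K D C).
Local Notation q := (quotient_exp D).

Let C_uniq : uniq C. Proof. by case: hC => _ [_ /andP[]]. Qed.

Let packed s m := exists2 t, (t <= s %/ (n + 1))%N & packs D C (s - t * (n + 1)) t m.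

Let symbolic_packed s : symbolic_power I s = mon_ideal K (packed s).
Proof.
rewrite (symbolic_power_edge K C hsink); apply: mon_ideal_eq => m.
rewrite /covers_weigh (cover_packing_iff hC hsize); split.
  by move=> [E [t [ts hE sE mE]]]; exists t => //; exists E.
by move=> [t ts [E [hE sE mE]]]; exists E, t.
Qed.

Lemma symbolic_power_small k : (1 <= k <= n)%N ->
  symbolic_power I k = ideal_pow I k.
Proof.
move=> /andP[k1 kn]; rewrite symbolic_packed (ideal_pow_edge K C hsink).
have k0 : (k %/ (n + 1) = 0)%N by rewrite divn_small // addn1.
apply: mon_ideal_eq => m; rewrite /packed k0; split; last first.
  by move=> h; exists 0%N => //; rewrite mul0n subn0.
by move=> [t]; rewrite leqn0 => /eqP ->; rewrite mul0n subn0.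
Qed.

Lemma symbolic_power_sum s k r : s = (k * (n + 1) + r)%N -> (r <= n)%N ->
  symbolic_power I s = \big[@ideal_add _/ideal0]_(0 <= t < k.+1)
    ideal_mul (ideal_pow I (s - t * (n + 1))%N) (ideal_pow (ideal_gen [set c]) t).
Proof.
move=> Es rn; rewrite symbolic_packed.
have sk : (s %/ (n + 1) = k)%N.
  by rewrite Es divnMDl ?addn1 // divn_small ?addn0.
under eq_bigr => t _ do rewrite (mixed_ideal_packs K hsink C_uniq).
rewrite big_ideal_add_mon; last by move=> t; exact: packs_up.
by apply: mon_ideal_eq => m; rewrite /packed sk; split=> -[t tk pk]; exists t;
  rewrite // ?mem_index_iota // in tk *.
Qed.

Lemma symbolic_power_first :
  symbolic_power I (n + 1)%N =
  ideal_add (ideal_pow I (n + 1)%N) (ideal_gen [set c]).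
Proof.
rewrite symbolic_packed (ideal_pow_edge K C hsink) (cycle_ideal_packs K D C_uniq).
rewrite ideal_add_mon; [|exact: packs_up..].
apply: mon_ideal_eq => m; rewrite /packed divnn addn1 /=; split.
  move=> [[|[|t]] // _]; rewrite ?mul0n ?mul1n ?subn0 ?subnn; first by left.
  by right.
move=> [h|h]; [exists 0%N | exists 1%N] => //.
by rewrite mul1n subnn.
Qed.

(** As weights are at least one, an edge costs at least degree two, and a cycle costs its total
    weight. *)
Let mdeg_ge s t m : packs D C s t m ->
  (2 * s + t * \sum_(v <- C) weight D v <= mdeg m)%N.
Proof.
move=> [E [hE <- mE]]; rewrite -sum_mult mdeg_exponent.
have -> : (\sum_(v <- C) weight D v = \sum_v (v \in C) * weight D v)%N.
  rewrite big_uniq //= big_mkcond; apply: eq_bigr => v _.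
  by case: (v \in C); rewrite ?mul1n.
rewrite big_distrr -big_split; apply: leq_sum => v _ /=.
have := mE v; rewrite leq_quotient_exp; apply: leq_trans.
by rewrite mulnDl mulnA leq_add2r leq_pmulr // weight_gt0.
Qed.

(* The witness is [(xy)^s c^t], for an edge of the cycle whose two ends [x] and
   [y] have weight one; it exists because the cycle is odd. *)
Let packs_degree s t : exists2 m, packs D C s t m &
  mdeg m = (2 * s + t * \sum_(v <- C) weight D v)%N.
Proof.
have [x [y [xy xC yC xP yP]]] : exists x y,
    [/\ adj D x y, x \in C, y \in C, x \notin Vplus D & y \notin Vplus D].
  apply: (cycle_edge_off hC hsize) => x y; rewrite /adj => /orP[xy|yx] hx.
    by have := hsink hx y; rewrite xy.
  by apply/negP => hy; have := hsink hy x; rewrite yx.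
have wx : weight D x = 1%N by move: xP; rewrite /Vplus finset.inE negbK => /eqP.
have wy : weight D y = 1%N by move: yP; rewrite /Vplus finset.inE negbK => /eqP.
pose e v := (s * ((x == v) + (y == v)) + t * (v \in C))%N.
have me v : mult (nseq s (x, y)) v = (s * ((x == v) + (y == v)))%N.
  elim: (s) => [|k IH]; first by rewrite mult_nil.
  by rewrite mult_cons IH mulSn.
exists (monomial_of (fun v => e v * weight D v)%N).
  exists (nseq s (x, y)); split; rewrite ?size_nseq //.
    by rewrite /edge_list all_nseq /= xy orbT.
  by move=> v; rewrite leq_quotient_exp exponent_monomial me.
rewrite mdeg_exponent; under eq_bigr => v _ do rewrite exponent_monomial.
have -> : (\sum_(v <- C) weight D v = \sum_v (v \in C) * weight D v)%N.
  rewrite big_uniq //= big_mkcond; apply: eq_bigr => v _.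
  by case: (v \in C); rewrite ?mul1n.
have S1 z : weight D z = 1%N -> (\sum_v (z == v) * weight D v = 1)%N.
  move=> wz; rewrite (bigD1 z) //= eqxx wz big1 // => v /negPf.
  by rewrite eq_sym => ->.
under eq_bigr => v _ do rewrite /e mulnDl -!mulnA mulnDl.
rewrite big_split -!big_distrr big_split /= !S1 //; lia.
Qed.

(** A copy of the cycle has degree [2 * n + 1] and replaces [n + 1] edges of degree two, so it saves
    one; the optimum uses as many copies as fit. *)
Lemma alpha_symbolic_off :
  (forall x, x \in C -> x \notin Vplus D) ->
  forall s, alpha (symbolic_power I s) = (2 * s - s %/ (n + 1))%N.
Proof.
move=> hoff s; rewrite symbolic_packed; set k := (s %/ (n + 1))%N.
have wC : (\sum_(v <- C) weight D v = 2 * n + 1)%N.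
  rewrite -hsize -sum1_size big_seq [RHS]big_seq; apply: eq_bigr => v /hoff.
  by rewrite /Vplus finset.inE negbK => /eqP.
have tk t : (t <= k)%N -> (t * (n + 1) <= s)%N.
  by move=> ht; apply: leq_trans (leq_trunc_div s (n + 1)); rewrite leq_mul2r ht orbT.
have degE t : (t <= k)%N ->
    (2 * (s - t * (n + 1)) + t * (2 * n + 1) = 2 * s - t)%N.
  by move=> /tk; lia.
apply: alpha_mon_ideal.
  have [m hm dm] := packs_degree (s - k * (n + 1)) k.
  by exists m; [exists k | rewrite dm wC degE].
move=> m [t ht /mdeg_ge]; rewrite wC degE //; apply: leq_trans.
by rewrite leq_sub2l.
Qed.

(** Now a copy of the cycle has degree at least [2 * n + 2], no less than the [n + 1] edges it
    replaces, so the optimum uses edges only. *)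
Lemma alpha_symbolic_on :
  (exists2 x, x \in C & x \in Vplus D) ->
  forall s, alpha (symbolic_power I s) = (2 * s)%N.
Proof.
move=> [x xC xP] s; rewrite symbolic_packed.
have wC : (2 * n + 2 <= \sum_(v <- C) weight D v)%N.
  rewrite (bigD1_seq x) //=.
  have : (size C <= 1 + \sum_(v <- C | v != x) weight D v)%N.
    rewrite -sum1_size (bigD1_seq x) //= leq_add2l leq_sum // => v _.
    exact: weight_gt0.
  have : (1 < weight D x)%N.
    have := weight_gt0 D x; move: xP; rewrite /Vplus finset.inE; lia.
  rewrite hsize; lia.
apply: alpha_mon_ideal.
  have [m hm dm] := packs_degree s 0.
  by exists m; [exists 0%N => //; rewrite mul0n subn0 | rewrite dm mul0n addn0].
move=> m [t ht /mdeg_ge]; apply: leq_trans.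
have : (t * (n + 1) <= s)%N.
  by apply: leq_trans (leq_trunc_div s (n + 1)); rewrite leq_mul2r ht orbT.
have : (t * (2 * n + 2) <= t * \sum_(v <- C) weight D v)%N by rewrite leq_mul2l wC orbT.
lia.
Qed.

End OddUnicyclicEdgeIdeal.

Theorem proposition3p9 (R : realType) (K : fieldType) (V : finType)
    (D : wograph V) (n : nat) (C : seq V)
    (hn : (1 <= n)%N)
    (hVplus : exists x : V, x \in Vplus D)
    (hsink : forall x : V, x \in Vplus D -> is_sink D x)
    (hsize : size C = (2 * n + 1)%N)
    (hC : unicyclic_with_cycle D C) :
  let I := edge_ideal K D in
  let c := cycle_monomial K D C in
  [/\ (forall k : nat, (1 <= k <= n)%N ->
         symbolic_power I k = ideal_pow I k) /\
      symbolic_power I (n + 1)%N =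
        ideal_add (ideal_pow I (n + 1)%N) (ideal_gen [set c]),
      forall s k r : nat, (1 <= s)%N -> s = (k * (n + 1) + r)%N -> (r <= n)%N ->
        symbolic_power I s =
        \big[@ideal_add _/ideal0]_(0 <= t < k.+1)
          ideal_mul (ideal_pow I (s - t * (n + 1))%N)
                    (ideal_pow (ideal_gen [set c]) t),
      (forall x : V, x \in C -> x \notin Vplus D) ->
      (exists x : V, x \notin C /\ x \in Vplus D) ->
        (forall s : nat, (1 <= s)%N ->
           alpha (symbolic_power I s) = (2 * s - s %/ (n + 1))%N) /\
        (cvg (waldschmidt_seq R I @ \oo) /\
         waldschmidt R I = (2 * n + 1)%:R / (n + 1)%:R) &
      (exists x : V, x \in C /\ x \in Vplus D) ->
        (forall s : nat, (1 <= s)%N ->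
           alpha (symbolic_power I s) = (2 * s)%N) /\
        (cvg (waldschmidt_seq R I @ \oo) /\ waldschmidt R I = 2)].
Proof.
move=> I c; split.
- split; first by move=> k; exact: (symbolic_power_small K hsink hsize hC).
  exact: (symbolic_power_first K hsink hsize hC).
- by move=> s k r _; exact: (symbolic_power_sum K hsink hsize hC).
- move=> hoff _; have al := alpha_symbolic_off K hsink hsize hC hoff.
  split=> [s _|]; first exact: al.
  (* With [s = k * (n + 1) + r], the degree [2 * s - k] exceeds [s * (2 * n + 1) / (n + 1)] by
     [r / (n + 1)], which lies between 0 and 1. *)
  apply: waldschmidt_of_bounds => s s0; rewrite al.
  have n0 : 0 < (n + 1)%:R :> R by rewrite ltr0n addn1.
  rewrite mulrAC ler_pdivrMr // -lerBlDr ler_pdivlMr // mulrBl mul1r lerBlDr.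
  rewrite -!natrM -natrD !ler_nat.
  have := divn_eq s (n + 1); have : (s %% (n + 1) < n + 1)%N by rewrite ltn_mod addn1.
  move: (s %/ (n + 1))%N (s %% (n + 1))%N => k r rn Es; apply/andP; split; nia.
- move=> [x [xC xP]].
  have al := alpha_symbolic_on K hsink hsize hC (ex_intro2 _ _ x xC xP).
  split=> [s _|]; first exact: al.
  by apply: waldschmidt_of_bounds => s _; rewrite al natrM lexx lerDl ler01.
Qed.
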